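(* For each $n\ge 3$ and each $k\ge 5$, $\mathrm{ex}_{\mathcal{P}}^*(n,C_k)=3n-6$.
   Context: All graphs are finite and simple. A proper edge-coloring of a graph assigns colors to edges so that edges sharing an endpoint get different colors. An edge-colored graph is rainbow if no two of its edges receive the same color. For a fixed graph $H$, the rainbow planar Turán number $\mathrm{ex}_{\mathcal{P}}^*(n,H)$ is the maximum number of edges in an $n$-vertex planar graph that admits a proper edge-coloring containing no rainbow copy of $H$ (as a subgraph). $C_k$ denotes the cycle on $k$ vertices. *)

(* Defs.v *)
From HB Require Import structures.
From mathcomp Require Import all_boot all_order all_algebra.
From mathcomp Require Import all_classical all_reals all_analysis.

Set Implicit Arguments.
Unset Strict Implicit.
Unset Printing Implicit Defensive.

Import Order.TTheory GRing.Theory Num.Theory.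
Import numFieldNormedType.Exports.

Local Open Scope set_scope.
Local Open Scope nat_scope.

(* A finite simple graph on the vertex set V, given by its set of edges, each
   edge being the two-element set of its endpoints. *)
Record sgraph (V : finType) := SGraph {
  edges :> {set {set V}};
  edgesP : [forall e in edges, #|e| == 2]
}.

HB.instance Definition _ (V : finType) := [isSub for @edges V].
HB.instance Definition _ (V : finType) := [Finite of sgraph V by <:].

(* ordS is the cyclic successor on 'I_k. The side condition i != ordS i only
   matters when k = 1, where it discards the loop. *)
Definition cycle_edges (k : nat) : {set {set 'I_k}} :=
  [set [set i; ordS i] | i : 'I_k & i != ordS i].

Lemma cycle_edgesP (k : nat) : [forall e in cycle_edges k, #|e| == 2].
Proof.
by apply/forall_inP => e /imsetP[i]; rewrite inE => ne ->; rewrite cards2 ne.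
Qed.

Definition cycle_graph (k : nat) : sgraph 'I_k := SGraph (cycle_edgesP k).

Section Coloring.
Variable V : finType.

(* Only the values of c on the edges of G are relevant. *)
Definition proper_edge_coloring (G : sgraph V) (c : {set V} -> nat) : Prop :=
  forall e f : {set V}, e \in edges G -> f \in edges G ->
    e != f -> ~~ [disjoint e & f] -> c e != c f.

Definition rainbow (c : {set V} -> nat) (F : {set {set V}}) : Prop :=
  {in F &, injective c}.

(* phi embeds H in G; the edge set of the resulting copy of H is
   [set phi @: h | h in edges H]. *)
Definition has_rainbow_copy (W : finType) (H : sgraph W)
    (G : sgraph V) (c : {set V} -> nat) : Prop :=
  exists phi : W -> V,
    [/\ injective phi,
        [set phi @: (h : {set W}) | h in edges H] \subset edges G
      & rainbow c [set phi @: (h : {set W}) | h in edges H]].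

End Coloring.

Section Planarity.
Variables (R : realType) (V : finType).
Local Open Scope ring_scope.

(* A drawing of G in the plane: vertices are distinct points, the edge e is the
   simple arc gamma e on [0, 1] joining its endpoints, and the interior of an
   arc meets neither a vertex nor another arc. *)
Definition plane_drawing (G : sgraph V) (pos : V -> R * R)
    (gamma : {set V} -> R -> R * R) : Prop :=
  [/\ injective pos,
      forall e : {set V}, e \in edges G ->
        [/\ {within (`[0, 1] : set R), continuous (gamma e)}%classic,
            {in `[0, 1] &, injective (gamma e)}
          & exists u v : V,
              [/\ e = [set u; v], gamma e 0 = pos u & gamma e 1 = pos v]],
      forall (e : {set V}) (v : V) (t : R),
        e \in edges G -> t \in `]0, 1[ -> gamma e t <> pos v
    & forall (e f : {set V}) (s t : R),
        e \in edges G -> f \in edges G -> e != f ->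
        s \in `]0, 1[ -> t \in `[0, 1] -> gamma e s <> gamma f t].

Definition planar (G : sgraph V) : Prop :=
  exists pos gamma, plane_drawing G pos gamma.

End Planarity.

Definition rainbow_planar_turan (R : realType) (n : nat)
    (W : finType) (H : sgraph W) : nat :=
  \max_(G : sgraph 'I_n |
      `[< planar R G /\
          exists c : {set 'I_n} -> nat,
            proper_edge_coloring G c /\ ~ has_rainbow_copy H G c >])
    #|edges G|.

(* Main.v *)
Require Import Defs.
From mathcomp Require Import all_boot all_order all_algebra.
From mathcomp Require Import all_classical all_reals all_analysis.
From mathcomp Require Import ring lra zify.

(* Upper bound. Cover the plane by a very fine square grid. Compactness gives
   pairwise disjoint squares around the vertices outside of which the arcs stay
   apart, so rounding the arcs to the grid exhibits the graph as a minor of the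
   grid. A cycle of the grid is the boundary of a set of cells, hence the cycle
   space of the minor is spanned by the boundaries of f faces, the classes of
   cells that are joined through deleted grid edges; as the sum of all these
   boundaries is 0, the edge count m satisfies m - (n - 1) <= f - 1. The
   boundary of a face is a nonzero flow on a simple graph, so it has at least
   three edges, while an edge bounds at most two faces: 3 f <= 2 m. Hence
   m <= 3 n - 6. Cycles are signed, with rational coefficients, so that no
   arithmetic in characteristic 2 is needed.

   Lower bound. The cube of the path on n vertices has 3 n - 6 edges. It is
   planar: repeatedly insert the barycentre of a triangle and join it to the
   three corners, the next triangle being formed by the new point and the last
   two. A periodic colouring with six colours has no rainbow cycle of length 5
   or 6 (a finite check), and six colours leave none of length at least 7. *)

Set Implicit Arguments.
Unset Strict Implicit.
Unset Printing Implicit Defensive.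

Import Order.TTheory GRing.Theory Num.Theory.
Import numFieldNormedType.Exports.

Local Open Scope set_scope.
Local Open Scope ring_scope.

(** * Counting faces *)

Lemma card_setIn_sum (T : finType) (A : {set T}) (P : pred T) :
  (#|[set x in A | P x]| = \sum_(x in A) P x)%N.
Proof.
rewrite -sum1_card (eq_bigl (fun x => (x \in A) && P x)) => [|x].
  by rewrite big_mkcondr; apply: eq_bigr => x _; case: (P x).
by rewrite inE.
Qed.

(** * Edge bound for a graph with an abstract dual, by ranks of rational matrices *)

Section AbstractDual.
Variables (V : finType) (E : {set {set V}}) (src tgt : {set V} -> V).
Hypothesis endsE : forall e, e \in E -> e = [set src e; tgt e].
Hypothesis ends_neq : forall e, e \in E -> src e != tgt e.

Definition incidence (e : {set V}) (v : V) : rat :=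
  (tgt e == v)%:R - (src e == v)%:R.

Definition is_flow (z : {set V} -> rat) : Prop :=
  forall v, \sum_(e in E) z e * incidence e v = 0.

Lemma incidence_neq0 (e : {set V}) v :
  e \in E -> (incidence e v != 0) = (v \in e).
Proof.
move=> eE; rewrite [in RHS](endsE eE) !inE /incidence.
rewrite ![v == _]eq_sym.
have := ends_neq eE.
case: (eqVneq (src e) v) => [->|_]; last by case: (tgt e == v).
by rewrite eq_sym => /negPf ->.
Qed.

(** By conservation at [v], a single nonzero term cannot cancel alone. *)
Lemma flow_support_other z e v : is_flow z -> e \in E -> z e != 0 -> v \in e ->
  exists f, [/\ f \in E, z f != 0, v \in f & f != e].
Proof.
move=> zf eE ze ve.
have [/existsP[f /and4P[? ? ? ?]]|/existsPn no] :=
  boolP [exists f, [&& f \in E, z f != 0, v \in f & f != e]]; first by exists f.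
have := zf v; rewrite (bigD1 e) //= big1 => [|f /andP[fE fe]].
  rewrite addr0 => /eqP; rewrite mulf_eq0 (negPf ze) /=.
  by rewrite -[_ == 0]negbK incidence_neq0 // ve.
have := no f; rewrite fE fe andbT /= negb_and negbK.
case/orP => [/eqP->|]; first by rewrite mul0r.
by rewrite -(incidence_neq0 _ fE) negbK => /eqP->; rewrite mulr0.
Qed.

(** The flow continues from each end of [e] along a further support edge. The two differ, since an
    edge containing both ends is [e] itself. *)
Lemma flow_support_ge3 z : is_flow z -> (exists2 e, e \in E & z e != 0) ->
  (3 <= #|[set e in E | z e != 0%R]|)%N.
Proof.
move=> zf [e eE ze].
have [|f [fE fz ef fe]] := flow_support_other (v := src e) zf eE ze.
  by move: (set21 (src e) (tgt e)); rewrite -(endsE eE).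
have [|g [gE gz eg ge]] := flow_support_other (v := tgt e) zf eE ze.
  by move: (set22 (src e) (tgt e)); rewrite -(endsE eE).
have fg : f != g.
  apply: contraNneq fe => fg; rewrite -fg in eg.
  have card2 h : h \in E -> #|h| = 2.
    by move=> hE; rewrite (endsE hE) cards2 ends_neq.
  rewrite eq_sym eqEcard !card2 // andbT.
  have -> : (e \subset f) = ([set src e; tgt e] \subset f) by rewrite -(endsE eE).
  by apply/fintype.subsetP => x; rewrite !inE => /orP[]/eqP->.
have c3 : #|[set e; f; g]| = 3.
  by rewrite -finset.setUA cardsU1 cards2 fg !inE negb_or ![e == _]eq_sym fe ge.
rewrite -[X in (X <= _)%N]c3; apply: subset_leq_card; apply/fintype.subsetP => x.
by rewrite !inE => /orP[/orP[]|] /eqP->; rewrite ?eE ?fE ?gE.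
Qed.

Variables (F : finType) (l r : {set V} -> F).
(** With [flow_is_cut]: in the dual graph, where [e] joins [l e] and [r e], the potential
    differences are exactly the flows on [E]. *)
Hypothesis cut_is_flow : forall chi : F -> rat,
  is_flow (fun e => chi (l e) - chi (r e)).
Hypothesis flow_is_cut : forall z, is_flow z ->
  exists chi : F -> rat, forall e, e \in E -> z e = chi (l e) - chi (r e).

Let bd (phi : F) (e : {set V}) : rat := (l e == phi)%:R - (r e == phi)%:R.
(** [F] will be the type of all cells, so only elements with a nonzero boundary count as faces. *)
Let faces : {set F} := [set phi | [exists e in E, bd phi e != 0]].

Let bd_flow phi : is_flow (bd phi).
Proof. exact: (cut_is_flow (fun psi => (psi == phi)%:R)). Qed.

(** Double counting of the pairs of a face and an edge on its boundary. *)
Let card_faces : (3 * #|faces| <= 2 * #|E|)%N.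
Proof.
have -> : (3 * #|faces| = \sum_(phi in faces) 3)%N.
  by rewrite sum_nat_const mulnC.
have -> : (2 * #|E| = \sum_(e in E) 2)%N by rewrite sum_nat_const mulnC.
apply: (@leq_trans (\sum_(phi in faces) \sum_(e in E) (bd phi e != 0%R))%N).
  apply: leq_sum => phi; rewrite inE => /exists_inP[e eE ze].
  apply: leq_trans (flow_support_ge3 (bd_flow phi) _) _; first by exists e.
  by rewrite card_setIn_sum.
rewrite exchange_big /=; apply: leq_sum => e eE.
rewrite -card_setIn_sum.
apply: (@leq_trans #|[set l e; r e]|); last by rewrite cards2; case: (_ != _).
apply: subset_leq_card; apply/fintype.subsetP => phi; rewrite !inE => /andP[_].
rewrite /bd !(eq_sym _ phi).
by case: (phi == l e) => //=; case: (phi == r e).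
Qed.

Let m := #|E|.
Let n := #|V|.
Let f := #|faces|.
Let incmx : 'M[rat]_(m, n) :=
  \matrix_(i, j) incidence (enum_val i) (enum_val j).
Let bdmx : 'M[rat]_(f, m) := \matrix_(i, j) bd (enum_val i) (enum_val j).

(** The constant vector is in the kernel, as every edge has one head and one tail. *)
Let rank_incmx : (0 < n)%N -> (\rank incmx < n)%N.
Proof.
move=> n0.
have H : incmx *m (const_mx 1 : 'cV_n) = 0.
  apply/matrixP => i j; rewrite !mxE.
  under eq_bigr do rewrite !mxE mulr1.
  rewrite -(big_enum_val (A := V) (fun v => incidence (enum_val i) v)) /=.
  rewrite sumrB -!natr_sum.
  have sum1 x : (\sum_(v in V) (x == v) = 1)%N.
    by rewrite (bigD1 x) //= eqxx big1 // => v /negPf; rewrite eq_sym => ->.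
  by rewrite !sum1 subrr.
have := mulmx0_rank_max H.
rewrite -(mxrank_tr (const_mx 1)) rank_rV trmx_const.
have -> : (const_mx 1 : 'rV[rat]_n) != 0.
  by apply/eqP => /matrixP/(_ 0 (Ordinal n0))/eqP; rewrite !mxE oner_eq0.
by rewrite addn1.
Qed.

(** The face boundaries sum to 0: an edge with distinct sides gets 1 from one side and -1 from the
    other. *)
Let rank_bdmx : (\rank bdmx <= f.-1)%N.
Proof.
case: (posnP f) => [f0|f0]; first by rewrite (leq_trans (rank_leq_row _)) ?f0.
have H : (const_mx 1 : 'rV_f) *m bdmx = 0.
  apply/matrixP => i j; rewrite !mxE.
  under eq_bigr do rewrite !mxE mul1r.
  set e := enum_val j.
  transitivity (\sum_(phi in faces) bd phi e); first by rewrite [RHS]big_enum_val.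
  have eE : e \in E by apply: enum_valP.
  have [lr|lr] := eqVneq (l e) (r e).
    by rewrite big1 // => phi _; rewrite /bd lr subrr.
  have lF : l e \in faces.
    rewrite inE; apply/exists_inP; exists e => //.
    by rewrite /bd eqxx [r e == _]eq_sym (negPf lr).
  have rF : r e \in faces.
    by rewrite inE; apply/exists_inP; exists e; rewrite // /bd eqxx (negPf lr).
  rewrite (bigD1 (l e)) //= (bigD1 (r e)) /=; last by rewrite rF eq_sym.
  rewrite big1 => [|phi /andP[/andP[_ pl] pr]].
    by rewrite /bd !eqxx [r e == _]eq_sym (negPf lr).
  by rewrite /bd ![_ == phi]eq_sym (negPf pl) (negPf pr).
have := mulmx0_rank_max H.
rewrite rank_rV.
have -> : (const_mx 1 : 'rV[rat]_f) != 0.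
  by apply/eqP => /matrixP/(_ 0 (Ordinal f0))/eqP; rewrite !mxE oner_eq0.
by move: (\rank bdmx) => a; lia.
Qed.

(** A flow is a potential difference of some [chi], hence the combination of the face boundaries
    with coefficients [chi phi]. *)
Let ker_incmx_sub : (kermx incmx <= bdmx)%MS.
Proof.
apply/rV_subP => w /sub_kermxP wk.
pose z e : rat := \sum_(i < m | enum_val i == e) w 0 i.
have zE i : z (enum_val i) = w 0 i.
  rewrite /z (bigD1 i) //= big1 ?addr0 // => j.
  by case/andP=> /eqP/enum_val_inj->; rewrite eqxx.
have /flow_is_cut[chi chiE] : is_flow z.
  move=> v; move/matrixP/(_ 0 (enum_rank v)): wk; rewrite !mxE => wk.
  rewrite -[RHS]wk big_enum_val.
  by apply: eq_bigr => i _; rewrite !mxE enum_rankK zE.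
apply/submxP; exists (\row_i chi (enum_val i)).
apply/rowP => j; rewrite !mxE -zE chiE; last exact: enum_valP.
under eq_bigr do rewrite !mxE.
set e := enum_val j.
transitivity (\sum_(phi in faces) chi phi * bd phi e); last by rewrite big_enum_val.
have -> : \sum_(phi in faces) chi phi * bd phi e = \sum_phi chi phi * bd phi e.
  rewrite [RHS](bigID (mem faces)) /= [X in _ + X]big1 ?addr0 // => phi.
  rewrite inE negb_exists_in => /forall_inP/(_ e (enum_valP j)).
  by rewrite negbK => /eqP->; rewrite mulr0.
under eq_bigr do rewrite /bd mulrBr.
have pick x : \sum_i chi i * (x == i)%:R = chi x.
  rewrite (bigD1 x) //= eqxx mulr1 big1 ?addr0 // => i /negPf.
  by rewrite eq_sym => ->; rewrite mulr0.
by rewrite sumrB !pick.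
Qed.

Theorem card_edges_of_dual : (3 <= n)%N -> (m <= 3 * n - 6)%N.
Proof.
move=> n3.
(* The kernel has dimension at least [m - (n - 1)] and at most [f.-1]. For [f = 0] this reads
   [m <= n - 1], within the bound because [3 <= n]. *)
have := mxrankS ker_incmx_sub; rewrite mxrank_ker.
have := rank_incmx (ltn_trans (ltn0Sn 1) n3).
have := rank_bdmx; have := card_faces; rewrite -/f -/m.
move: (\rank incmx) (\rank bdmx) => a b.
lia.
Qed.

End AbstractDual.

(** * Minors of a grid *)

(* The grid is a torus; the seam [i = 0] or [j = 0] will carry no vertex of the
   minor, which makes it behave as a planar grid while keeping all shifts
   bijective. *)
Section Grid.
Variable M : nat.
Notation pt := ('I_M * 'I_M)%type.
Implicit Types (p q : pt).

Definition east p : pt := (ordS p.1, p.2).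
Definition west p : pt := (ord_pred p.1, p.2).
Definition north p : pt := (p.1, ordS p.2).
Definition south p : pt := (p.1, ord_pred p.2).

Lemma eastK : cancel east west.
Proof. by case=> i j; rewrite /west /east /= ordSK. Qed.
Lemma northK : cancel north south.
Proof. by case=> i j; rewrite /north /south /= ordSK. Qed.

(* The edge [(true, p)] joins [p] to [east p], and [(false, p)] joins [p] to
   [north p]; the cell [p] has lower left corner [p]. *)
Notation gedge := (bool * pt)%type.
Definition gsrc (g : gedge) : pt := g.2.
Definition gtgt (g : gedge) : pt := if g.1 then east g.2 else north g.2.
Definition gne (g : gedge) : pt := g.2.
Definition gsw (g : gedge) : pt := if g.1 then south g.2 else west g.2.
(* The cell on the left of an edge minus the cell on its right: [gne] is on the
   left of an eastward edge and on the right of a northward one. *)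
Definition gcobd (chi : pt -> rat) (g : gedge) : rat :=
  if g.1 then chi (gne g) - chi (gsw g) else chi (gsw g) - chi (gne g).

Definition gbd (c : gedge -> rat) p : rat :=
  c (true, west p) - c (true, p) + c (false, south p) - c (false, p).

(** Each of the four cells around [p] enters twice, with opposite signs. *)
Lemma gbd_gcobd chi p : gbd (gcobd chi) p = 0.
Proof.
rewrite /gbd /gcobd /gne /gsw /=.
have -> : west (south p) = south (west p) by [].
ring.
Qed.

Lemma sum_gedge (f : gedge -> rat) :
  \sum_g f g = \sum_p f (true, p) + \sum_p f (false, p).
Proof.
have -> : \sum_g f g = \sum_b \sum_p f (b, p).
  by rewrite pair_bigA; apply: eq_bigr => -[].
by rewrite (bigD1 true) //= (bigD1 false) //= [X in _ + (_ + X)]big1 ?addr0 // => -[].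
Qed.

(** Summation by parts; there are no end terms because the shifts of the torus are bijective. *)
Lemma sum_gbd c (a : pt -> rat) :
  \sum_p a p * gbd c p = \sum_g c g * (a (gtgt g) - a (gsrc g)).
Proof.
rewrite sum_gedge /gbd /gtgt /gsrc /=.
under eq_bigr do rewrite mulrBr mulrDr mulrBr.
rewrite !(sumrB, big_split) /=.
rewrite (reindex_inj (can_inj eastK)) /=.
under eq_bigr do rewrite eastK.
rewrite [X in _ + X - _](reindex_inj (can_inj northK)) /=.
under [X in _ + X - _]eq_bigr do rewrite northK.
rewrite -sumrB -addrA -sumrB.
by congr (_ + _); apply: eq_bigr => p _; ring.
Qed.

Definition gadj (p q : pt) : bool :=
  [exists g, (gsrc g == p) && (gtgt g == q) || (gsrc g == q) && (gtgt g == p)].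

Lemma gadj_sym p q : gadj p q = gadj q p.
Proof. by apply: eq_existsb => g; rewrite orbC. Qed.

Lemma sum_indic (T : finType) (x : T) (f : T -> rat) :
  \sum_y f y * (y == x)%:R = f x.
Proof.
by rewrite (bigD1 x) //= eqxx mulr1 big1 ?addr0 // => y /negPf->; rewrite mulr0.
Qed.

Lemma gbdE c p : gbd c p = \sum_g c g * ((gtgt g == p)%:R - (gsrc g == p)%:R).
Proof.
rewrite -(sum_gbd c (fun q => (q == p)%:R)).
by under eq_bigr do rewrite mulrC; rewrite sum_indic.
Qed.

Lemma gbd_lin (I : finType) (a : I -> rat) (c : I -> gedge -> rat) p :
  gbd (fun g => \sum_i a i * c i g) p = \sum_i a i * gbd (c i) p.
Proof.
rewrite /gbd -!(sumrB, big_split) /=.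
by apply: eq_bigr => i _; ring.
Qed.

Lemma val_ord_pred (i : 'I_M) : (0 < i)%N -> val (ord_pred i) = i.-1.
Proof.
case: i => i iM /= i0; case: i i0 iM => // i _ iM.
by rewrite addSn /= modnDr modn_small // ltnW.
Qed.

Lemma val_ord_pred0 (i : 'I_M) : val i = 0%N -> val (ord_pred i) = M.-1.
Proof.
case: i => i iM /= ->; rewrite add0n modn_small // prednK //.
exact: leq_ltn_trans iM.
Qed.

Definition osum (f : 'I_M -> rat) (j : 'I_M) : rat :=
  \sum_(k : 'I_M | (k <= j)%N) f k.

Lemma osum0 f (j : 'I_M) : val j = 0%N -> osum f j = f j.
Proof.
move=> j0; rewrite /osum (bigD1 j) //= big1 ?addr0 // => k /andP[kj /eqP[]].
by apply/val_inj/eqP; rewrite j0 -leqn0 -[X in (_ <= X)%N]j0.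
Qed.

Lemma osum_pred f (j : 'I_M) : (0 < j)%N -> osum f j = osum f (ord_pred j) + f j.
Proof.
move=> j0; rewrite /osum (bigD1 j) //= addrC; congr (_ + _).
apply: eq_bigl => k; have /= -> := val_ord_pred j0.
by rewrite -(inj_eq val_inj) /=; case: (j : nat) j0 => // j' _; lia.
Qed.

Lemma osum_last f (j : 'I_M) : val j = M.-1 -> osum f j = \sum_k f k.
Proof.
move=> jM; apply: eq_bigl => k; have := ltn_ord k.
by rewrite [nat_of_ord j]jM; lia.
Qed.

(** The difference at index 0 wraps around to the last value, which is 0 by hypothesis. *)
Lemma osum_telescope f (j : 'I_M) :
  (forall k, val k = M.-1 -> f k = 0) ->
  osum (fun k => f k - f (ord_pred k)) j = f j.
Proof.
move=> fM; move: {2}(val j) (erefl (val j)) => n.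
elim: n j => [|n IH] j jn.
  by rewrite osum0 // (fM (ord_pred j)) ?subr0 //; apply: val_ord_pred0.
have j0 : (0 < j)%N by rewrite [nat_of_ord j]jn.
by rewrite osum_pred // IH ?val_ord_pred // ?[nat_of_ord j]jn //; ring.
Qed.

(* The first homology of the grid cut along the seam vanishes: a cycle is the
   coboundary of its column sums. *)
Lemma gcycle_gcobd c :
    (forall p, gbd c p = 0) ->
    (forall p, val p.1 = 0%N -> c (true, p) = 0) ->
    (forall p, val p.2 = M.-1 -> c (false, p) = 0) ->
  exists chi, forall g, c g = gcobd chi g.
Proof.
move=> cyc c0 cM.
(* Conservation summed over a column shows that the same total leaves every column; at the seam it
   is 0. *)
have col0 i : \sum_j c (true, (i, j)) = 0.
  move: {2}(val i) (erefl (val i)) => n.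
  elim: n i => [|n IH] i iE; first by rewrite big1 // => j _; rewrite c0.
  have /IH predi : val (ord_pred i) = n.
    by rewrite val_ord_pred ?[nat_of_ord i]iE.
  have : \sum_j gbd c (i, j) = 0 by rewrite big1.
  rewrite /gbd !(sumrB, big_split) /= predi.
  rewrite [X in _ + X - _](reindex_inj (can_inj (@ordSK M))) /=.
  rewrite /south /=; under [X in _ + X - _]eq_bigr do rewrite ordSK.
  by rewrite sub0r addrK => /eqP; rewrite oppr_eq0 => /eqP.
exists (fun p => osum (fun j => c (true, (p.1, j))) p.2) => -[[] [i j]].
  rewrite /gcobd /gne /gsw /=.
  (* The cell south of row 0 wraps to the last row, where [chi] is the full column sum, namely 0. *)
  have [j0|j0] := posnP j.
    by rewrite osum0 // [X in _ - X]osum_last ?val_ord_pred0 // col0 subr0.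
  by rewrite osum_pred //; ring.
rewrite /gcobd /gne /gsw /=.
(* Conservation at [(i, k)] trades the two horizontal edges for the two vertical ones, whose
   differences telescope. *)
rewrite -(osum_telescope (f := fun k => c (false, (i, k)))) => [|k kM].
  rewrite /osum -sumrB; apply: eq_bigr => k _.
  have := cyc (i, k); rewrite /gbd /west /south /= => e.
  by apply/eqP; rewrite -subr_eq0; apply/eqP; rewrite -[RHS]oppr0 -e; ring.
by rewrite cM.
Qed.

Definition gwithin (S : {set pt}) : rel pt :=
  fun p q => [&& gadj p q, p \in S & q \in S].

Lemma gwithin_sym S : connect_sym (gwithin S).
Proof.
apply: sym_connect_sym => p q.
by rewrite /gwithin gadj_sym [in RHS]andbCA andbA andbC andbA.
Qed.

Lemma connect_gwithin_sub (S T : {set pt}) p q :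
  S \subset T -> connect (gwithin S) p q -> connect (gwithin T) p q.
Proof.
move=> /fintype.subsetP ST; apply: connect_sub => x y /and3P[xy xS yS].
by apply: connect1; rewrite /gwithin xy !ST.
Qed.

(** Every vertex of a path to [q] still reaches [q], so the path stays in the component. *)
Lemma connect_gwithin_comp S p q : connect (gwithin S) p q ->
  connect (gwithin [set x in S | connect (gwithin S) x q]) p q.
Proof.
case/connectP=> s; elim: s p => [|y s IH] p /=; first by move=> _ ->.
case/andP=> py ys qE; apply: connect_trans (IH _ ys qE); apply: connect1.
have yq : connect (gwithin S) y q by apply/connectP; exists s.
have /and3P[pyadj pS yS] := py.
by rewrite /gwithin pyadj !inE pS yS yq (connect_trans (connect1 py) yq).
Qed.

End Grid.

(** * Flows on a minor of the grid, and the faces it cuts out *)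

Section GridMinor.
Variables (M : nat) (V : finType) (E : {set {set V}}).
Notation pt := ('I_M * 'I_M)%type.
Notation gedge := (bool * pt)%type.
Variables (A : V -> {set pt}) (src tgt : {set V} -> V) (G : {set V} -> gedge).
Hypothesis endsE : forall e, e \in E -> e = [set src e; tgt e].
Hypothesis ends_neq : forall e, e \in E -> src e != tgt e.
Hypothesis A_inj : forall u v p, p \in A u -> p \in A v -> u = v.
Hypothesis A_seam : forall v p, p \in A v -> (0 < p.1)%N /\ (0 < p.2)%N.
Hypothesis A_conn : forall v, {in A v &, forall p q, connect (gwithin (A v)) p q}.
Hypothesis G_src : forall e, e \in E -> gsrc (G e) \in A (src e).
Hypothesis G_tgt : forall e, e \in E -> gtgt (G e) \in A (tgt e).

Let indic v p : rat := (p \in A v)%:R.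

Let indicE u v p : p \in A u -> indic v p = (u == v)%:R.
Proof.
move=> pu; rewrite /indic; have [<-|uv] := eqVneq u v; first by rewrite pu.
by case: (boolP (p \in A v)) => // /(A_inj pu) /eqP; rewrite (negPf uv).
Qed.

Let G_injective : {in E &, injective G}.
Proof.
move=> e f eE fE ef; rewrite (endsE eE) (endsE fE).
have := G_src eE; rewrite ef => /A_inj/(_ (G_src fE)) ->.
by have := G_tgt eE; rewrite ef => /A_inj/(_ (G_tgt fE)) ->.
Qed.

(** Grid edges inside a branch set [A v] are contracted, those in [G @: E] represent [E], and all
    others are deleted. *)
Let inner (g : gedge) := [exists v, (gsrc g \in A v) && (gtgt g \in A v)].
Let kept (g : gedge) := inner g || (g \in G @: E).

Let inner_indic g v : inner g -> indic v (gtgt g) - indic v (gsrc g) = 0.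
Proof. by case/existsP=> u /andP[gs gt]; rewrite !(indicE v gs, indicE v gt) subrr. Qed.

Let kept_seam g : kept g -> (0 < (gsrc g).1)%N /\ (0 < (gtgt g).2)%N.
Proof.
case/orP => [/existsP[u /andP[/A_seam[? _] /A_seam[]]]|/imsetP[e eE ->]] //.
by case: (A_seam (G_src eE)) (A_seam (G_tgt eE)) => ? _ [].
Qed.

Let G_not_inner e : e \in E -> ~~ inner (G e).
Proof.
move=> eE; apply/existsP => -[u /andP[us ut]].
have := ends_neq eE.
by rewrite (A_inj (G_src eE) us) (A_inj (G_tgt eE) ut) eqxx.
Qed.

(** Summation by parts against the indicator of a branch set: contracted edges cancel, deleted ones
    carry nothing. *)
Let sum_fibre (c : gedge -> rat) v :
    (forall g, ~~ kept g -> c g = 0) ->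
  \sum_p indic v p * gbd c p = \sum_(e in E) c (G e) * incidence src tgt e v.
Proof.
move=> c0; rewrite sum_gbd (bigID (mem (G @: E))) /= [X in _ + X]big1 ?addr0.
  rewrite big_imset //=; apply: eq_bigr => e eE.
  by rewrite (indicE _ (G_tgt eE)) (indicE _ (G_src eE)).
move=> g gE; have [/inner_indic->|gi] := boolP (inner g); first by rewrite mulr0.
by rewrite c0 ?mul0r // /kept negb_or gi.
Qed.

Let cellrel (c d : pt) := [exists g, ~~ kept g &&
  ((gne g == c) && (gsw g == d) || (gne g == d) && (gsw g == c))].

Let cellrel_sym : connect_sym cellrel.
Proof.
apply: sym_connect_sym => c d.
by apply: eq_existsb => g; rewrite [in RHS]orbC.
Qed.

Let face c := fingraph.root cellrel c.

Let face_unkept g : ~~ kept g -> face (gne g) = face (gsw g).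
Proof.
move=> gk; apply/(fingraph.rootP cellrel_sym)/connect1/existsP.
by exists g; rewrite gk !eqxx.
Qed.

Let lface e := if (G e).1 then face (gne (G e)) else face (gsw (G e)).
Let rface e := if (G e).1 then face (gsw (G e)) else face (gne (G e)).

(** A grid coboundary has no net inflow at any point, hence none on a branch set; being constant on
    faces, [chi \o face] gives 0 on deleted edges. *)
Let cut_is_flow (chi : pt -> rat) :
  is_flow E src tgt (fun e => chi (lface e) - chi (rface e)).
Proof.
move=> v; pose c := gcobd (chi \o face).
transitivity (\sum_p indic v p * gbd c p); last first.
  by rewrite big1 // => p _; rewrite gbd_gcobd mulr0.
rewrite sum_fibre => [|g gk]; last first.
  by rewrite /c /gcobd /= face_unkept // subrr if_same.
apply: eq_bigr => e _; rewrite /c /gcobd /lface /rface /=.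
by case: (G e).1.
Qed.

Let innerrel (p q : pt) :=
  gadj p q && [exists v, (p \in A v) && (q \in A v)].

Let innerrel_sym : connect_sym innerrel.
Proof.
apply: sym_connect_sym => p q; rewrite /innerrel gadj_sym; congr (_ && _).
by apply: eq_existsb => v; rewrite andbC.
Qed.

Let innerrel_conn v p q : p \in A v -> q \in A v -> connect innerrel p q.
Proof.
move=> pv qv; apply: connect_sub (A_conn pv qv) => x y /and3P[xy xv yv].
by apply: connect1; rewrite /innerrel xy; apply/existsP; exists v; rewrite xv.
Qed.

Let innerrel_closed v p q : connect innerrel p q -> p \in A v -> q \in A v.
Proof.
move=> /connectP[s]; elim: s p => [|x s IH] p /=; first by move=> _ ->.
case/andP=> /andP[_ /existsP[u /andP[pu xu]]] /IH{}IH /IH{}IH pv.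
by apply: IH; rewrite -(A_inj pu pv).
Qed.

(** A unit flow from [p] to [q] is sent along a path of contracted edges. *)
Let chain p q : connect innerrel p q -> exists k : gedge -> rat,
  (forall g, ~~ inner g -> k g = 0) /\
  (forall x, gbd k x = (x == q)%:R - (x == p)%:R).
Proof.
case/connectP=> s; elim: s p => [|y s IH] p /=.
  move=> _ ->; exists (fun=> 0); split=> // x.
  by rewrite gbdE big1 ?subrr // => g _; rewrite mul0r.
case/andP=> /andP[/existsP[g gpy] /existsP[v /andP[pv yv]]] /IH{}IH /IH[k [k0 kq]].
have gi : inner g.
  by apply/existsP; exists v; case/orP: gpy => /andP[/eqP-> /eqP->]; rewrite pv yv.
(* The sign is -1 when the grid edge points against the path. *)
pose a : rat := if (gsrc g == p) && (gtgt g == y) then 1 else -1.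
exists (fun h => \sum_(b : bool) (if b then 1 else a) *
                 (if b then k h else (h == g)%:R)); split=> [h hi|x].
  rewrite big1 // => -[] _; first by rewrite k0 // mulr0.
  by case: eqVneq hi => [->|_]; rewrite ?gi ?mulr0.
rewrite (gbd_lin _ (fun b h => if b then k h else (h == g)%:R)) big_bool /= kq mul1r.
rewrite gbdE; under eq_bigr do rewrite mulrC; rewrite sum_indic {}/a.
case: (boolP (_ && _)) gpy => [/andP[/eqP-> /eqP->] _|_ /= /andP[/eqP-> /eqP->]];
  by rewrite !(eq_sym x) ?[p == x]eq_sym; ring.
Qed.

Let flow_is_cut z : is_flow E src tgt z ->
  exists chi : pt -> rat, forall e, e \in E -> z e = chi (lface e) - chi (rface e).
Proof.
move=> zf; pose zh g : rat := \sum_(e in E | G e == g) z e.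
have zhG e : e \in E -> zh (G e) = z e.
  move=> eE; rewrite /zh (bigD1 e) /= ?eE ?eqxx // big1 ?addr0 // => f.
  by case/andP=> /andP[fE /eqP/G_injective->] //; rewrite eqxx.
have zh0 g : g \notin G @: E -> zh g = 0.
  move=> gE; rewrite /zh big1 // => e /andP[eE /eqP eg].
  by move: gE; rewrite -eg imset_f.
have zhk g : ~~ kept g -> zh g = 0 by rewrite negb_or => /andP[_ /zh0].
pose D := gbd zh.
(* Lifted to the grid, [z] is conserved only in total over each branch set; [D] is the defect at
   single points. *)
have D_fibre v : \sum_p indic v p * D p = 0.
  by rewrite sum_fibre // -[RHS](zf v); apply: eq_bigr => e eE; rewrite zhG.
have D0 p : (forall v, p \notin A v) -> D p = 0.
  move=> pA; rewrite /D gbdE big1 // => g _.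
  have [/imsetP[e eE ->]|/zh0->] := boolP (g \in G @: E); last by rewrite mul0r.
  have -> : (gtgt (G e) == p) = false.
    by apply: contraNF (pA (tgt e)) => /eqP<-; apply: G_tgt.
  have -> : (gsrc (G e) == p) = false.
    by apply: contraNF (pA (src e)) => /eqP<-; apply: G_src.
  by rewrite subrr mulr0.
have /boolp.choice[k kP] p : exists k : gedge -> rat,
    (forall g, ~~ inner g -> k g = 0) /\
    (forall x, gbd k x = (x == p)%:R - (x == fingraph.root innerrel p)%:R).
  by apply: chain; rewrite innerrel_sym fingraph.connect_root.
(* The defects of a branch set, all moved to its root, cancel there. *)
have D_root x : \sum_p D p * (x == fingraph.root innerrel p)%:R = 0.
  have [xr|xr] := eqVneq (fingraph.root innerrel x) x; last first.
    rewrite big1 // => p _.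
    case: (eqVneq x (fingraph.root innerrel p)) xr => [->|_ _]; last by rewrite mulr0.
    by rewrite fingraph.root_root ?eqxx.
  have [/existsP[v xv]|/existsPn xA] := boolP [exists v, x \in A v].
    rewrite -[RHS](D_fibre v); apply: eq_bigr => p _; rewrite mulrC.
    have [/existsP[u pu]|/existsPn pA] := boolP [exists u, p \in A u]; last first.
      by rewrite D0 // !mulr0.
    rewrite /indic; congr (_%:R * _); congr nat_of_bool; apply/eqP/idP => [xp|pv].
      by apply: innerrel_closed xv; rewrite innerrel_sym xp fingraph.connect_root.
    by rewrite -[LHS]xr; apply/(fingraph.rootP innerrel_sym); apply: innerrel_conn xv pv.
  rewrite big1 // => p _.
  have [/existsP[u pu]|/existsPn pA] := boolP [exists u, p \in A u]; last first.
    by rewrite D0 // mul0r.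
  case: eqP => [xp|_]; last by rewrite mulr0.
  have := xA u; rewrite xp => /negP[].
  by apply: innerrel_closed pu; apply: fingraph.connect_root.
(* [kap] runs inside the branch sets and has the same defect as [zh], so [zh - kap] is a cycle of
   the grid. *)
pose kap g := \sum_p D p * k p g.
have kap0 g : ~~ inner g -> kap g = 0.
  by move=> gi; rewrite /kap big1 // => p _; rewrite (kP p).1 // mulr0.
have bd_kap x : gbd kap x = D x.
  rewrite /kap gbd_lin; under eq_bigr do rewrite (kP _).2 mulrBr.
  rewrite sumrB D_root subr0; under eq_bigr do rewrite eq_sym.
  exact: sum_indic.
pose c g := zh g - kap g.
have ck g : ~~ kept g -> c g = 0.
  by move=> gk; rewrite /c zhk // kap0 ?subrr //; move: gk; rewrite negb_or => /andP[].
have [|||chi chiE] := @gcycle_gcobd M c.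
- by move=> p; have := bd_kap p; rewrite /D /c /gbd => e; lra.
- move=> p p0; apply: ck; apply/negP => /kept_seam[].
  by rewrite /gsrc /= [nat_of_ord p.1]p0.
- move=> p pM; apply: ck; apply/negP => /kept_seam[_].
  rewrite /gtgt /= [nat_of_ord p.2]pM prednK ?modnn //.
  by case: p.1 => i; apply: leq_ltn_trans.
exists chi => e eE.
(* The cycle vanishes on deleted edges, so its potential is constant on each face. *)
have chi_const x y : connect cellrel x y -> chi x = chi y.
  case/connectP=> s; elim: s x => [|w s IH] x /=; first by move=> _ ->.
  case/andP=> /existsP[g /andP[gk gxw]] /IH{}IH /IH <-.
  have : gcobd chi g = 0 by rewrite -chiE ck.
  rewrite /gcobd => h.
  have {h} : chi (gne g) = chi (gsw g).
    by move: h; case: (g.1) => /eqP; rewrite subr_eq0 => /eqP.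
  by case/orP: gxw => /andP[/eqP-> /eqP->].
have chi_face x : chi (face x) = chi x.
  by apply/esym/chi_const/fingraph.connect_root.
have : z e = gcobd chi (G e) by rewrite -chiE /c zhG // kap0 ?subr0 // G_not_inner.
rewrite /gcobd /lface /rface.
by case: (G e).1 => ->; rewrite !chi_face.
Qed.

Theorem card_edges_grid_minor : (3 <= #|V|)%N -> (#|E| <= 3 * #|V| - 6)%N.
Proof. exact: (card_edges_of_dual endsE ends_neq cut_is_flow flow_is_cut). Qed.

End GridMinor.

Lemma connect_crossing (T : finType) (r : rel T) (P : pred T) x y :
  connect r x y -> ~~ P x -> P y -> exists u v, [/\ r u v, ~~ P u & P v].
Proof.
case/connectP=> s; elim: s x => [|z s IH] x /=; first by move=> _ -> /negPf->.
case/andP=> xz zs yE Px Py; have [Pz|Pz] := boolP (P z); first by exists x, z.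
exact: IH zs yE Pz Py.
Qed.

(** * From grid neighbourhoods of vertices and arcs to disjoint branch sets *)

Section GridDrawing.
Variables (M : nat) (V : finType) (E : {set {set V}}).
Notation pt := ('I_M * 'I_M)%type.
Notation gedge := (bool * pt)%type.
Variables (src tgt : {set V} -> V).
Variables (B : V -> {set pt}) (b : V -> pt) (N : {set V} -> {set pt}).
Hypothesis endsE : forall e, e \in E -> e = [set src e; tgt e].
Hypothesis ends_neq : forall e, e \in E -> src e != tgt e.
Hypothesis b_in : forall v, b v \in B v.
Hypothesis B_inj : forall u v p, p \in B u -> p \in B v -> u = v.
Hypothesis B_seam : forall v p, p \in B v -> (0 < p.1)%N /\ (0 < p.2)%N.
Hypothesis N_seam : forall e p, e \in E -> p \in N e -> (0 < p.1)%N /\ (0 < p.2)%N.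
Hypothesis B_conn : forall v p, p \in B v -> connect (gwithin (B v)) p (b v).
Hypothesis N_conn : forall e, e \in E ->
  connect (gwithin (N e)) (b (src e)) (b (tgt e)).
Hypothesis N_avoid : forall e w p, e \in E -> p \in N e -> p \in B w -> w \in e.
Hypothesis N_disj : forall e f p, e \in E -> f \in E -> e != f ->
  p \in N e -> p \in N f -> exists w, p \in B w.

Let free e : {set pt} := [set p in N e | [forall w, p \notin B w]].
Let S e := free e :|: B (tgt e).
Let Y e := [set p in S e | connect (gwithin (S e)) p (b (tgt e))].
(* The part of the arc [e] that can be reached from [B (tgt e)] without meeting
   another [B w] is contracted into its end [tgt e]. *)
Let A v := [set p | (p \in B v) || [exists e in E, (tgt e == v) && (p \in Y e)]].

Let A_cases v p : p \in A v ->
  p \in B v \/ exists e, [/\ e \in E, tgt e = v, p \in free e & p \in Y e].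
Proof.
rewrite inE => /orP[|/existsP[e /and3P[eE /eqP <- pY]]]; first by left.
have := pY; rewrite 3!inE => /andP[/orP[pf|pB] _]; last by left.
by right; exists e; split=> //; rewrite inE.
Qed.

Let free_B e p w : p \in free e -> p \in B w -> False.
Proof. by rewrite inE => /andP[_ /forallP/(_ w)/negPf->]. Qed.

(** Distinct arcs share grid points only inside the sets [B w], which the free parts avoid. *)
Let A_inj u v p : p \in A u -> p \in A v -> u = v.
Proof.
move=> /A_cases[pu|[e [eE <- pe _]]] /A_cases[pv|[f [fE <- pf _]]].
- exact: B_inj pu pv.
- by case: (free_B pf pu).
- by case: (free_B pe pv).
have [->//|ef] := eqVneq e f.
have [w pw] : exists w, p \in B w.
  by apply: N_disj eE fE ef _ _; move: pe pf; rewrite !inE => /andP[? _] /andP[? _].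
by case: (free_B pe pw).
Qed.

Let A_seam v p : p \in A v -> (0 < p.1)%N /\ (0 < p.2)%N.
Proof.
case/A_cases => [|[e [eE _ + _]]]; first exact: B_seam.
by rewrite inE => /andP[+ _]; apply: N_seam.
Qed.

Let Y_sub e : e \in E -> Y e \subset A (tgt e).
Proof.
move=> eE; apply/fintype.subsetP => p pY; rewrite inE; apply/orP; right.
by apply/existsP; exists e; rewrite eE eqxx.
Qed.

Let A_conn v : {in A v &, forall p q, connect (gwithin (A v)) p q}.
Proof.
have toroot p : p \in A v -> connect (gwithin (A v)) p (b v).
  case/A_cases => [pB|[e [eE <- _ pY]]].
    apply: connect_gwithin_sub (B_conn pB).
    by apply/fintype.subsetP => x; rewrite inE => ->.
  apply: connect_gwithin_sub (Y_sub eE) _; apply: connect_gwithin_comp.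
  by move: pY; rewrite inE => /andP[].
move=> p q /toroot pv /toroot qv; apply: connect_trans pv _.
by rewrite gwithin_sym.
Qed.

Let A_adj e : e \in E ->
  exists p q, [/\ gadj p q, p \in A (src e) & q \in A (tgt e)].
Proof.
move=> eE.
have bY : b (tgt e) \in Y e by rewrite !inE b_in orbT connect0.
have bnY : b (src e) \notin Y e.
  rewrite !inE negb_and negb_or; apply/orP; left; apply/andP; split.
    by rewrite negb_and; apply/orP; right; apply/forallPn; exists (src e); rewrite negbK.
  apply: contra (ends_neq eE) => bt; apply/eqP; exact: B_inj (b_in _) bt.
have [x [y [/and3P[xy xN yN] xY yY]]] :=
  connect_crossing (P := mem (Y e)) (N_conn eE) bnY bY.
exists x, y; split=> //; last exact: (fintype.subsetP (Y_sub eE)).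
(* A point of [S e] adjacent to [Y e] would belong to [Y e]. So [x] lies in some [B w] other than
   [B (tgt e)], and this leaves only [B (src e)]. *)
have xS : x \notin S e.
  apply: contra xY => xS; rewrite /= inE xS /=.
  move: yY; rewrite /= inE => /andP[yS]; apply: connect_trans.
  by apply: connect1; rewrite /gwithin xy xS.
move: xS; rewrite 2!inE negb_or negb_and xN /= => /andP[/forallPn[w]].
rewrite negbK => xw xt; rewrite inE; apply/orP; left.
have : w \in [set src e; tgt e] by rewrite -(endsE eE) (N_avoid eE xN xw).
rewrite !inE => /orP[]/eqP wE.
  by rewrite -wE.
by rewrite -wE xw in xt.
Qed.

Theorem card_edges_grid_drawing : (3 <= #|V|)%N -> (#|E| <= 3 * #|V| - 6)%N.
Proof.
(* A nonempty [E] provides the default [x0] for the choice below, which ranges over all vertex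
   sets. *)
have [->|[e0 e0E]] := set_0Vmem E; first by rewrite cards0.
(* The grid edge may run from [tgt e] to [src e], so each edge is oriented anew along its grid
   edge. *)
have gE e : e \in E -> exists x : gedge * V * V,
    [/\ e = [set x.1.2; x.2], gsrc x.1.1 \in A x.1.2 & gtgt x.1.1 \in A x.2].
  move=> eE; have [p [q [/existsP[g gpq] pA qA]]] := A_adj eE.
  case/orP: gpq => /andP[/eqP gs /eqP gt].
    by exists (g, src e, tgt e); rewrite /= gs gt; split=> //; apply: endsE.
  exists (g, tgt e, src e); rewrite /= gs gt; split=> //.
  by rewrite finset.setUC; apply: endsE.
have [x0 _] := gE _ e0E.
have /boolp.choice[h hP] e : exists x : gedge * V * V, e \in E ->
    [/\ e = [set x.1.2; x.2], gsrc x.1.1 \in A x.1.2 & gtgt x.1.1 \in A x.2].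
  have [/gE[x xP]|_] := boolP (e \in E); last by exists x0.
  by exists x.
apply: (card_edges_grid_minor (src := fun e => (h e).1.2) (tgt := fun e => (h e).2)
  (G := fun e => (h e).1.1) _ _ A_inj A_seam A_conn) => e eE;
  have [eh gs gt] // := hP e eE.
apply/eqP => h12; have : #|e| = 2 by rewrite (endsE eE) cards2 ends_neq.
by rewrite eh h12 finset.setUid cards1.
Qed.

End GridDrawing.

(** * Discretizing a drawing *)

Section GridConnect.
Variable M : nat.
Notation pt := ('I_M * 'I_M)%type.

Definition between (i j k : nat) : bool := (i <= k <= j)%N || (j <= k <= i)%N.

Lemma gadj_east (p : pt) : gadj p (east p).
Proof. by apply/existsP; exists (true, p); rewrite /gsrc /gtgt /= !eqxx. Qed.

Lemma gadj_north (p : pt) : gadj p (north p).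
Proof. by apply/existsP; exists (false, p); rewrite /gsrc /gtgt /= !eqxx. Qed.

Lemma val_ordS (i j : 'I_M) : (i < j)%N -> ordS i = i.+1 :> nat.
Proof. by move=> ij; rewrite /= modn_small // (leq_ltn_trans ij). Qed.

(* [line k] is a row or a column of the grid. *)
Lemma connect_line (S : {set pt}) (line : 'I_M -> pt) (i j : 'I_M) :
    (forall k, gadj (line k) (line (ordS k))) ->
    (forall k : 'I_M, between i j k -> line k \in S) ->
  connect (gwithin S) (line i) (line j).
Proof.
move=> ladj; wlog ij : i j / (i <= j)%N => [H lS|].
  have [ij|/ltnW ji] := leqP i j; first exact: H.
  rewrite gwithin_sym; apply: H => // k kb; apply: lS.
  by move: kb; rewrite /between orbC.
move: {2}(j - i)%N (erefl (j - i)%N) => n.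
elim: n i ij => [|n IH] i ij jin lS.
  by have -> : i = j by apply: val_inj => /=; lia.
have {}ij : (i < j)%N by lia.
have iS := val_ordS ij.
apply: (@connect_trans _ _ (line (ordS i))).
  apply: connect1; rewrite /gwithin ladj !lS // /between ?iS; lia.
by apply: IH => [||k]; rewrite ?iS; [lia..|]; move=> kb;
  apply: lS; move: kb; rewrite /between; lia.
Qed.

(** A row segment followed by a column segment stays in the box. *)
Lemma connect_box (S : {set pt}) (p q : pt) :
    (forall x : pt, between p.1 q.1 x.1 -> between p.2 q.2 x.2 -> x \in S) ->
  connect (gwithin S) p q.
Proof.
case: p q => [i j] [i' j'] /= box.
apply: (@connect_trans _ _ (i', j)).
  apply: (connect_line (line := fun k => (k, j))) => [k|k kb]; first exact: gadj_east.
  by apply: box => //=; rewrite /between; lia.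
apply: (connect_line (line := fun k => (i', k))) => [k|k kb]; first exact: gadj_north.
by apply: box => //=; rewrite /between; lia.
Qed.

End GridConnect.

(** * Rounding a drawing that is scaled to a grid of mesh 1 *)

Section Discretize.
Variable R : realType.

(* Sup-distance at most [d], in a form that linear arithmetic can use. *)
Definition close (d : R) (x y : R * R) : bool :=
  (- d <= x.1 - y.1 <= d) && (- d <= x.2 - y.2 <= d).

Lemma closeP d x y : reflect
  [/\ x.1 - y.1 <= d, y.1 - x.1 <= d, x.2 - y.2 <= d & y.2 - x.2 <= d] (close d x y).
Proof.
apply: (iffP idP) => [/andP[/andP[? ?] /andP[? ?]]|[? ? ? ?]]; first by split; lra.
by apply/andP; split; apply/andP; split; lra.
Qed.

Variables (M' : nat) (V : finType) (E : {set {set V}}).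
Notation M := M'.+1.
Notation pt := ('I_M * 'I_M)%type.
Variables (src tgt : {set V} -> V) (X : V -> R * R) (Ga : {set V} -> R -> R * R).
Variables (r d : R).
Hypothesis endsE : forall e, e \in E -> e = [set src e; tgt e].
Hypothesis ends_neq : forall e, e \in E -> src e != tgt e.
Hypothesis r2 : (2 : R) <= r.
Hypothesis d0 : 0 < d.
Hypothesis X_sep : forall u v, close (4 * r) (X u) (X v) -> u = v.
Hypothesis XGa_sep : forall e (t : R) w, e \in E -> 0 <= t <= 1 ->
  close (4 * r) (Ga e t) (X w) -> w \in e.
Hypothesis GaGa_sep : forall e f (s t : R), e \in E -> f \in E -> e != f ->
  0 <= s <= 1 -> 0 <= t <= 1 -> close 4 (Ga e s) (Ga f t) ->
  close r (Ga e s) (X (src e)) \/ close r (Ga e s) (X (tgt e)).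
Hypothesis Ga_step : forall e (s t : R), e \in E -> 0 <= s <= 1 -> 0 <= t <= 1 ->
  t - d <= s <= t -> close 1 (Ga e s) (Ga e t).
Hypothesis X_box : forall v,
  2 * r < (X v).1 < M%:R /\ 2 * r < (X v).2 < M%:R.
Hypothesis Ga_box : forall e (t : R), e \in E -> 0 <= t <= 1 ->
  2 < (Ga e t).1 < M%:R /\ 2 < (Ga e t).2 < M%:R.
Hypothesis Ga_src : forall e, e \in E -> Ga e 0 = X (src e).
Hypothesis Ga_tgt : forall e, e \in E -> Ga e 1 = X (tgt e).

Let cr (p : pt) : R * R := ((p.1 : nat)%:R, (p.2 : nat)%:R).
Let round (q : R * R) : pt := (inord (Num.truncn q.1), inord (Num.truncn q.2)).

Let round1 (x : R) : 0 <= x < M%:R ->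
  (@inord M' (Num.truncn x) : nat)%:R <= x < (@inord M' (Num.truncn x) : nat)%:R + 1.
Proof.
move=> /andP[x0 xM]; have /andP[tx xt] := truncn_itv x0.
rewrite inordK ?tx ?natr1 ?xt //.
by rewrite -(ltr_nat R) (le_lt_trans tx).
Qed.

Let roundP (q : R * R) : 0 <= q.1 < M%:R -> 0 <= q.2 < M%:R -> close 1 (cr (round q)) q.
Proof.
move=> /round1 /andP[a1 a2] /round1 /andP[b1 b2].
by apply/closeP; split=> /=; lra.
Qed.

Let betweenP (i j k : nat) : between i j k ->
  (i%:R <= k%:R :> R) && (k%:R <= j%:R :> R) || (j%:R <= k%:R :> R) && (k%:R <= i%:R :> R).
Proof. by rewrite !ler_nat. Qed.

(** The radius is half the separation [4 * r] of the vertices. It is at least [r + 2], so a grid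
    point within 2 of an arc point that is within [r] of the vertex is included. *)
Let B v : {set pt} := [set p | close (2 * r) (cr p) (X v)].
(** Radius 2 is the rounding error 1 plus the sampling step 1, so consecutive rounded samples are
    joined inside [N e]. *)
Let N e : {set pt} := [set p | `[< exists2 t : R, 0 <= t <= 1 & close 2 (cr p) (Ga e t) >]].
Let b v := round (X v).

Let b_close v : close 1 (cr (b v)) (X v).
Proof. by have := r2; have [/andP[? ?] /andP[? ?]] := X_box v => ?; apply: roundP; lra. Qed.

Let Ga_close e (t : R) : e \in E -> 0 <= t <= 1 -> close 1 (cr (round (Ga e t))) (Ga e t).
Proof. by move=> eE /(Ga_box eE)[/andP[? ?] /andP[? ?]]; apply: roundP; lra. Qed.

Let b_in v : b v \in B v.
Proof.
have r2' := r2; have /closeP[? ? ? ?] := b_close v.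
by rewrite inE; apply/closeP; split; lra.
Qed.

Let B_inj u v p : p \in B u -> p \in B v -> u = v.
Proof.
rewrite !inE => /closeP[? ? ? ?] /closeP[? ? ? ?]; apply: X_sep.
by apply/closeP; split; lra.
Qed.

Let cr_gt0 (p : pt) x e : close e (cr p) x -> e < x.1 -> e < x.2 ->
  (0 < p.1)%N /\ (0 < p.2)%N.
Proof. by move=> /closeP[/= ? ? ? ?] ? ?; rewrite -!(ltr_nat R); split; lra. Qed.

Let B_seam v p : p \in B v -> (0 < p.1)%N /\ (0 < p.2)%N.
Proof.
have [/andP[? ?] /andP[? ?]] := X_box v.
by rewrite inE => /cr_gt0; apply.
Qed.

Let N_seam e p : e \in E -> p \in N e -> (0 < p.1)%N /\ (0 < p.2)%N.
Proof.
move=> eE; rewrite inE => /asboolP[t /(Ga_box eE)[/andP[? ?] /andP[? ?]]] /cr_gt0.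
by apply.
Qed.

Let B_conn v p : p \in B v -> connect (gwithin (B v)) p (b v).
Proof.
move=> pB; apply: connect_box => x /betweenP x1 /betweenP x2.
move: pB (b_in v); rewrite !inE => /closeP[/= ? ? ? ?] /closeP[/= ? ? ? ?].
by case/orP: x1 => /andP[? ?]; case/orP: x2 => /andP[? ?]; apply/closeP; split=> /=; lra.
Qed.

Let N_step e (s t : R) : e \in E -> 0 <= s <= 1 -> 0 <= t <= 1 -> t - d <= s <= t ->
  connect (gwithin (N e)) (round (Ga e s)) (round (Ga e t)).
Proof.
move=> eE s01 t01 st; apply: connect_box => x /betweenP x1 /betweenP x2.
rewrite inE; apply/asboolP; exists s => //.
have /closeP[/= ? ? ? ?] := Ga_close eE s01.
have /closeP[/= ? ? ? ?] := Ga_close eE t01.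
have /closeP[/= ? ? ? ?] := Ga_step eE s01 t01 st.
by case/orP: x1 => /andP[? ?]; case/orP: x2 => /andP[? ?]; apply/closeP; split=> /=; lra.
Qed.

Let N_conn e : e \in E -> connect (gwithin (N e)) (b (src e)) (b (tgt e)).
Proof.
move=> eE; rewrite /b -Ga_src // -Ga_tgt //.
(* The arc is sampled at the multiples of [1 / K], a step of at most [d]. *)
pose K := (Num.truncn d^-1).+1.
have K0 : 0 < K%:R :> R by rewrite ltr0n.
have dK : d^-1 < K%:R by have := truncnS_gt d^-1.
have Kd : K%:R^-1 <= d by rewrite -[d]invrK lef_pV2 ?posrE ?invr_gt0 // ltW.
have H k : (k <= K)%N ->
    connect (gwithin (N e)) (round (Ga e 0)) (round (Ga e (k%:R / K%:R))).
  elim: k => [|k IH] kK; first by rewrite mul0r connect0.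
  apply: connect_trans (IH (ltnW kK)) _.
  have in01 j : (j <= K)%N -> 0 <= (j%:R / K%:R : R) <= 1.
    by move=> jK; rewrite divr_ge0 //= ler_pdivrMr // mul1r ler_nat.
  apply: N_step => //; [exact/in01/ltnW|exact: in01|].
  rewrite -natr1 mulrDl mul1r; move: (k%:R / K%:R) Kd => x.
  have := invr_gt0 (K%:R : R); rewrite K0.
  by move: (K%:R^-1) => y ? ?; apply/andP; split; lra.
by have := H K (leqnn K); rewrite divff // gt_eqF.
Qed.

Let N_avoid e w p : e \in E -> p \in N e -> p \in B w -> w \in e.
Proof.
move=> eE; rewrite inE => /asboolP[t t01 c1]; rewrite inE => c2; have r2' := r2.
move/closeP: c1 => [? ? ? ?]; move/closeP: c2 => [? ? ? ?].
by apply: XGa_sep eE t01 _; apply/closeP; split; lra.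
Qed.

Let N_disj e f p : e \in E -> f \in E -> e != f ->
  p \in N e -> p \in N f -> exists w, p \in B w.
Proof.
move=> eE fE ef; rewrite inE => /asboolP[s s01 c1]; rewrite inE => /asboolP[t t01 c2].
have r2' := r2.
move/closeP: c1 => [? ? ? ?]; move/closeP: c2 => [? ? ? ?].
have [|sE|sE] := GaGa_sep eE fE ef s01 t01.
- by apply/closeP; split; lra.
- exists (src e); move/closeP: sE => [? ? ? ?].
  by rewrite inE; apply/closeP; split; lra.
- exists (tgt e); move/closeP: sE => [? ? ? ?].
  by rewrite inE; apply/closeP; split; lra.
Qed.

Theorem card_edges_discretized : (3 <= #|V|)%N -> (#|E| <= 3 * #|V| - 6)%N.
Proof.
exact: (card_edges_grid_drawing endsE ends_neq b_in B_inj B_seam N_seam B_conn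
  N_conn N_avoid N_disj).
Qed.

End Discretize.

(** * Uniform positive constants from compactness and finiteness *)

Section Compactness.
Variable R : realType.

(** Compactness of the segment, as a near-covering property, is applied to the filter of right
    neighbourhoods of 0. *)
Lemma unit_segment_uniform (P : R -> R -> Prop) :
    (forall t d d' : R, P t d -> 0 < d' -> d' <= d -> P t d') ->
    (forall t : R, 0 <= t <= 1 -> exists2 d : R, 0 < d &
      forall t' : R, 0 <= t' <= 1 -> `|t' - t| < d -> P t' d) ->
  exists2 d : R, 0 < d & forall t : R, 0 <= t <= 1 -> P t d.
Proof.
move=> Pd Ploc.
have := @segment_compact R 0 1; rewrite compact_near_coveringP.
move=> /(_ R ((0 : R)^'+)%classic (fun d t => 0 <= t <= 1 -> P t d) _)[|d /= d0 dP].
- move=> t; rewrite /= in_itv /= => /Ploc[d d0 tP].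
  exists (ball t d, [set i | 0 < i < d])%classic => /=.
    split; first exact: nbhsx_ballx.
    exists d => //= i /=; rewrite sub0r normrN => id i0.
    by rewrite i0 (le_lt_trans (ler_norm _) id).
  move=> [x i] [/= xt /andP[i0 id]] x01; apply: Pd (tP _ x01 _) i0 (ltW id).
  by rewrite distrC.
(* [dP] covers only values strictly below [d], hence the half. *)
exists (d / 2); first by rewrite divr_gt0.
move=> t t01; apply: (dP (d / 2)) => //=.
- by rewrite sub0r normrN gtr0_norm ?divr_gt0 // ltr_pdivrMr // ltr_pMr // ltr1n.
- by rewrite divr_gt0.
Qed.

Lemma finite_uniform (T : finType) (P : T -> R -> Prop) :
    (forall x (d d' : R), P x d -> 0 < d' -> d' <= d -> P x d') ->
    (forall x, exists2 d : R, 0 < d & P x d) ->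
  exists2 d : R, 0 < d & forall x, P x d.
Proof.
move=> Pd Pex.
suff [d d0 dP] : exists2 d : R, 0 < d & forall x, x \in enum T -> P x d.
  by exists d => // x; apply: dP; rewrite mem_enum.
elim: (enum T) => [|x s [d d0 dP]]; first by exists 1.
have [d' d'0 xP] := Pex x.
exists (Num.min d d'); first by rewrite lt_min d0.
move=> y; rewrite inE => /orP[/eqP->|/dP yP].
  by apply: Pd xP _ _; rewrite ?ge_min ?lexx ?orbT // lt_min d0.
by apply: Pd yP _ _; rewrite ?ge_min ?lexx // lt_min d0.
Qed.

Lemma within_continuousP (g : R -> R * R) :
    {within (`[0, 1] : set R), continuous g}%classic ->
  forall t e : R, 0 <= t <= 1 -> 0 < e -> exists2 d : R, 0 < d &
    forall t' : R, 0 <= t' <= 1 -> `|t' - t| < d -> close e (g t') (g t).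
Proof.
move=> /subspace_continuousP gc t e t01 e0.
have := gc t; rewrite /= in_itv /= => /(_ t01) /cvg_ball/(_ e e0).
rewrite near_withinE => -[d /= d0 dP]; exists d => // t' t'01 tt'.
have [] := dP t' _ _.
- by rewrite /= distrC.
- by rewrite /= in_itv.
rewrite /ball /= => h1 h2; rewrite /close -!ler_norml.
by rewrite ![`|(g t').1 - _|]distrC ![`|(g t').2 - _|]distrC !ltW.
Qed.

End Compactness.

(** * Separation estimates for a plane drawing, and its edge bound *)

Section PlanarBound.
Variable R : realType.
Implicit Types (d : R) (x y z : R * R).

Lemma closeC d x y : close d x y = close d y x.
Proof. by apply/closeP/closeP => -[]; split. Qed.

Lemma close_trans y x z d d' : close d x y -> close d' y z -> close (d + d') x z.
Proof. by move=> /closeP[? ? ? ?] /closeP[? ? ? ?]; apply/closeP; split; lra. Qed.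

Lemma close_le d d' x y : d <= d' -> close d x y -> close d' x y.
Proof. by move=> dd' /closeP[? ? ? ?]; apply/closeP; split; lra. Qed.

Lemma not_close x y : x <> y -> exists2 d, 0 < d & ~~ close d x y.
Proof.
case: x y => [x1 x2] [y1 y2] xy.
have [e1|n1] := eqVneq x1 y1; last first.
  exists (`|x1 - y1| / 2); first by rewrite divr_gt0 // normr_gt0 subr_eq0.
  rewrite negb_and -ler_norml -ltNge /=.
  have : 0 < `|x1 - y1| by rewrite normr_gt0 subr_eq0.
  by move: (`|_|) => a a0; apply/orP; left; lra.
have [e2|n2] := eqVneq x2 y2; first by case: xy; rewrite e1 e2.
exists (`|x2 - y2| / 2); first by rewrite divr_gt0 // normr_gt0 subr_eq0.
rewrite negb_and -!ler_norml -!ltNge /=.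
have : 0 < `|x2 - y2| by rewrite normr_gt0 subr_eq0.
by move: (`|x2 - y2|) => a a0; apply/orP; right; lra.
Qed.

Lemma close_bound x : exists2 c : R, 0 < c & close c x (0, 0).
Proof.
exists (`|x.1| + `|x.2| + 1); first by rewrite ltr_wpDl.
rewrite /close -!ler_norml !subr0 /=.
have := normr_ge0 x.1; have := normr_ge0 x.2.
by move: (`|_|) (`|_|) => a b ? ?; apply/andP; split; lra.
Qed.

Variables (V : finType) (E : {set {set V}}).
Variables (pos : V -> R * R) (ga : {set V} -> R -> R * R) (src tgt : {set V} -> V).
Hypothesis endsE : forall e, e \in E -> e = [set src e; tgt e].
Hypothesis ends_neq : forall e, e \in E -> src e != tgt e.
Hypothesis pos_inj : injective pos.
Hypothesis ga_cont : forall e, e \in E ->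
  forall t h : R, 0 <= t <= 1 -> 0 < h -> exists2 d, 0 < d &
    forall t' : R, 0 <= t' <= 1 -> `|t' - t| < d -> close h (ga e t') (ga e t).
Hypothesis ga_src : forall e, e \in E -> ga e 0 = pos (src e).
Hypothesis ga_tgt : forall e, e \in E -> ga e 1 = pos (tgt e).
Hypothesis ga_pos : forall e v (t : R), e \in E -> 0 < t < 1 -> ga e t <> pos v.
Hypothesis ga_ga : forall e f (s t : R), e \in E -> f \in E -> e != f ->
  0 < s < 1 -> 0 <= t <= 1 -> ga e s <> ga f t.

Let end_or_inner (t : R) : 0 <= t <= 1 -> [\/ t = 0, t = 1 | 0 < t < 1].
Proof.
rewrite !le_eqVlt => /andP[/orP[/eqP<-|t0] /orP[/eqP->|t1]].
- by constructor 1.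
- by constructor 1.
- by constructor 2.
- by constructor 3; rewrite t0.
Qed.

Let src_in e : e \in E -> src e \in e.
Proof. by move=> eE; move: (set21 (src e) (tgt e)); rewrite -(endsE eE). Qed.

Let tgt_in e : e \in E -> tgt e \in e.
Proof. by move=> eE; move: (set22 (src e) (tgt e)); rewrite -(endsE eE). Qed.

Let pos_sep : exists2 r, 0 < r & forall u v, close (4 * r) (pos u) (pos v) -> u = v.
Proof.
have [||r r0 rP] := @finite_uniform R _
  (fun uv : V * V => fun r => close (4 * r) (pos uv.1) (pos uv.2) -> uv.1 = uv.2).
- by move=> x d d' H _ dd' c; apply: H; apply: close_le c; lra.
- move=> [u v] /=; have [->|/eqP uv] := eqVneq u v; first by exists 1.
  have [|d d0 dP] := @not_close (pos u) (pos v); first by move/pos_inj.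
  exists (d / 4); first by rewrite divr_gt0.
  by rewrite mulrC divfK // (negPf dP).
by exists r => // u v; apply: (rP (u, v)).
Qed.

(** An arc misses every vertex other than its ends, hence by compactness stays at a positive
    distance from it. *)
Let ga_pos_sep : exists2 r, 0 < r & forall e (t : R) w, e \in E -> 0 <= t <= 1 ->
  close (4 * r) (ga e t) (pos w) -> w \in e.
Proof.
have [||r r0 rP] := @finite_uniform R _ (fun ew : {set V} * V => fun r =>
  forall t, ew.1 \in E -> 0 <= t <= 1 -> close (4 * r) (ga ew.1 t) (pos ew.2) ->
  ew.2 \in ew.1).
- move=> x d d' H d'0 dd' t xE t01 c; apply: H xE t01 (close_le _ c); lra.
- move=> [e w] /=; have [eE|eE] := boolP (e \in E); last by exists 1.
  have [we|we] := boolP (w \in e); first by exists 1.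
  have ne t : 0 <= t <= 1 -> ga e t <> pos w.
    case/end_or_inner => [->|->|/ga_pos]; last exact.
      by rewrite ga_src // => /pos_inj sw; move: we; rewrite -sw src_in.
    by rewrite ga_tgt // => /pos_inj sw; move: we; rewrite -sw tgt_in.
  have [||d d0 dP] := @unit_segment_uniform R (fun t d => ~~ close d (ga e t) (pos w)).
  + by move=> t d d' + _ dd'; apply: contra; apply: close_le.
  + move=> t t01; have [h h0 hP] := not_close (ne t t01).
    have h20 : 0 < h / 2 by rewrite divr_gt0.
    have [d d0 dP] := ga_cont eE t01 h20.
    exists (Num.min d (h / 2)); first by rewrite lt_min d0.
    move=> t' t'01; rewrite lt_min => /andP[/(dP _ t'01) c _].
    apply: contra hP => c'; rewrite closeC in c.
    have cc := close_trans c c'; apply: close_le cc.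
    have : Num.min d (h / 2) <= h / 2 by rewrite ge_min lexx orbT.
    by move: (Num.min _ _) => a; lra.
  exists (d / 4); first by rewrite divr_gt0.
  move=> t _ /dP; rewrite mulrC divfK // => /negPf -> //.
by exists r => // e t w; apply: (rP (e, w)).
Qed.

(** If [s] is 0 or 1, continuity gives one of the alternatives nearby; otherwise the two arc points
    differ and stay apart nearby. Compactness is used in [t], then in [s]. *)
Let ga_ga_sep r : 0 < r -> exists2 d, 0 < d & forall e f (s t : R),
  e \in E -> f \in E -> e != f -> 0 <= s <= 1 -> 0 <= t <= 1 ->
  close d (ga e s) (ga f t) ->
  close r (ga e s) (pos (src e)) \/ close r (ga e s) (pos (tgt e)).
Proof.
move=> r0.
pose Q e f s t d := close d (ga e s) (ga f t) ->
  close r (ga e s) (pos (src e)) \/ close r (ga e s) (pos (tgt e)).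
have Qd e f s t d d' : Q e f s t d -> d' <= d -> Q e f s t d'.
  by move=> H dd' c; apply: H; apply: close_le c.
have [||d d0 dP] := @finite_uniform R _ (fun ef : {set V} * {set V} => fun d =>
  forall s t : R, ef.1 \in E -> ef.2 \in E -> ef.1 != ef.2 -> 0 <= s <= 1 ->
  0 <= t <= 1 -> Q ef.1 ef.2 s t d).
- by move=> x d d' H _ dd' s t e1 e2 e3 e4 e5; apply: Qd (H s t e1 e2 e3 e4 e5) dd'.
- move=> [e f] /=.
  have [eE|eE] := boolP (e \in E); last by exists 1.
  have [fE|fE] := boolP (f \in E); last by exists 1.
  have [ef|ef] := eqVneq e f; first by exists 1.
  have loc s t : 0 <= s <= 1 -> 0 <= t <= 1 -> exists2 d, 0 < d &
      forall s' t' : R, 0 <= s' <= 1 -> 0 <= t' <= 1 ->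
      `|s' - s| < d -> `|t' - t| < d -> Q e f s' t' d.
    move=> s01 t01.
    case/end_or_inner: (s01) => [s0|s1|s_in].
    + have [d d0 dP] := ga_cont eE s01 r0; exists d => // s' t' s'01 t'01 ss' _ _.
      by left; rewrite -ga_src // -s0; apply: dP.
    + have [d d0 dP] := ga_cont eE s01 r0; exists d => // s' t' s'01 t'01 ss' _ _.
      by right; rewrite -ga_tgt // -s1; apply: dP.
    have [h h0 hP] := not_close (ga_ga eE fE ef s_in t01).
    have h30 : 0 < h / 3 by rewrite divr_gt0.
    have [d1 d10 d1P] := ga_cont eE s01 h30.
    have [d2 d20 d2P] := ga_cont fE t01 h30.
    exists (Num.min (Num.min d1 d2) (h / 3)); first by rewrite !lt_min d10 d20.
    move=> s' t' s'01 t'01; rewrite !lt_min => /andP[/andP[/(d1P _ s'01) c1 _] _].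
    move=> /andP[/andP[_ /(d2P _ t'01) c2] _] c; case/negP: hP.
    rewrite closeC in c1; have cc := close_trans (close_trans c1 c) c2.
    apply: close_le cc.
    have : Num.min (Num.min d1 d2) (h / 3) <= h / 3 by rewrite ge_min lexx orbT.
    move: (Num.min _ _) => a; lra.
  have [||d d0 dP] := @unit_segment_uniform R (fun s d =>
    forall t : R, 0 <= t <= 1 -> Q e f s t d).
  + by move=> s d d' H _ dd' t t01; apply: Qd (H t t01) dd'.
  + move=> s s01; have [||d d0 dP] := @unit_segment_uniform R (fun t d =>
      forall s' : R, 0 <= s' <= 1 -> `|s' - s| < d -> Q e f s' t d).
    * move=> t d d' H _ dd' s' s'01 ss'.
      exact: Qd (H s' s'01 (lt_le_trans ss' dd')) dd'.
    * move=> t t01; have [d d0 dP] := loc s t s01 t01.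
      by exists d => // t' t'01 tt' s' s'01 ss'; apply: dP.
    by exists d => // s' s'01 ss' t t01; apply: dP.
  by exists d => // s t _ _ _ s01; apply: dP.
by exists d => // e f s t; apply: (dP (e, f)).
Qed.

(** Uniform continuity of the finitely many arcs. *)
Let ga_step h : 0 < h -> exists2 d, 0 < d & forall e (s t : R),
  e \in E -> 0 <= s <= 1 -> 0 <= t <= 1 -> t - d <= s <= t ->
  close h (ga e s) (ga e t).
Proof.
move=> h0.
have [||d d0 dP] := @finite_uniform R _ (fun e d => e \in E ->
  forall t : R, 0 <= t <= 1 -> forall s : R, 0 <= s <= 1 -> `|s - t| < d ->
  close h (ga e s) (ga e t)).
- move=> e d d' H _ dd' eE t t01 s s01 st; apply: H => //.
  exact: lt_le_trans dd'.
- move=> e; have [eE|eE] := boolP (e \in E); last by exists 1.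
  have [||d d0 dP] := @unit_segment_uniform R (fun t d =>
    forall s : R, 0 <= s <= 1 -> `|s - t| < d -> close h (ga e s) (ga e t)).
  + move=> t d d' H _ dd' s s01 st; apply: H => //; exact: lt_le_trans dd'.
  + move=> t t01; have h20 : 0 < h / 2 by rewrite divr_gt0.
    have [d d0 dP] := ga_cont eE t01 h20.
    exists (d / 2); first by rewrite divr_gt0.
    move=> t' t'01 tt' s s01 st'; rewrite [h](@splitr R).
    apply: (@close_trans (ga e t)).
      apply: dP => //; have -> : s - t = (s - t') + (t' - t) by ring.
      apply: le_lt_trans (ler_normD _ _) _.
      by rewrite [d](@splitr R) ltrD.
    rewrite closeC; apply: dP => //; apply: lt_trans tt' _.
    by rewrite ltr_pdivrMr // ltr_pMr // ltr1n.
  by exists d.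
exists (d / 2); first by rewrite divr_gt0.
move=> e s t eE s01 t01 /andP[st1 st2]; apply: dP => //.
have -> : `|s - t| = t - s by rewrite distrC ger0_norm // subr_ge0.
by lra.
Qed.

Let drawing_bounded : exists2 L : R, 0 < L & (forall v, close L (pos v) (0, 0)) /\
  forall e (t : R), e \in E -> 0 <= t <= 1 -> close L (ga e t) (0, 0).
Proof.
(* The bound is written [d^-1], so that it weakens as [d] decreases, the form the uniformity lemmas
   take. *)
have mono d d' x : close d^-1 x (0, 0) -> 0 < d' -> d' <= d -> close d'^-1 x (0, 0).
  move=> c d'0 dd'; apply: close_le c; rewrite lef_pV2 ?posrE //.
  exact: lt_le_trans dd'.
have [||d1 d10 d1P] := @finite_uniform R _ (fun v d => close d^-1 (pos v) (0, 0)).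
- by move=> v d d'; apply: mono.
- move=> v; have [c c0 cP] := close_bound (pos v).
  by exists c^-1; rewrite ?invr_gt0 // invrK.
have [||d2 d20 d2P] := @finite_uniform R _ (fun e d => e \in E ->
  forall t : R, 0 <= t <= 1 -> close d^-1 (ga e t) (0, 0)).
- by move=> e d d' H d'0 dd' eE t t01; apply: mono (H eE t t01) d'0 dd'.
- move=> e; have [eE|eE] := boolP (e \in E); last by exists 1.
  have [||d d0 dP] := @unit_segment_uniform R (fun t d => close d^-1 (ga e t) (0, 0)).
  + by move=> t d d'; apply: mono.
  + move=> t t01; have [c c0 cP] := close_bound (ga e t).
    have [d d0 dP] := ga_cont eE t01 (@ltr01 R).
    have c10 : 0 < (1 + c)^-1 by rewrite invr_gt0 addr_gt0.
    have m0 : 0 < Num.min d (1 + c)^-1 by rewrite lt_min d0.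
    exists (Num.min d (1 + c)^-1) => // t' t'01.
    rewrite lt_min => /andP[/(dP _ t'01) c' _].
    have cc := close_trans c' cP; rewrite -[1 + c]invrK in cc.
    by apply: mono cc m0 _; rewrite ge_min lexx orbT.
  by exists d.
exists (Num.min d1 d2)^-1; first by rewrite invr_gt0 lt_min d10.
have m0 : 0 < Num.min d1 d2 by rewrite lt_min d10.
split=> [v|e t eE t01].
  by apply: mono (d1P v) m0 _; rewrite ge_min lexx.
by apply: mono (d2P e eE t t01) m0 _; rewrite ge_min lexx orbT.
Qed.

Theorem card_edges_drawing : (3 <= #|V|)%N -> (#|E| <= 3 * #|V| - 6)%N.
Proof.
have [r1 r10 r1P] := pos_sep.
have [r2 r20 r2P] := ga_pos_sep.
pose r := Num.min r1 r2.
have r0 : 0 < r by rewrite lt_min r10.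
have [rr1 rr2] : r <= r1 /\ r <= r2 by rewrite !ge_min !lexx orbT.
have [dl dl0 dlP] := ga_ga_sep r0.
(* [h] is the mesh: [r / 2] makes the scaled radius at least 2, and [dl / 4] makes a scaled distance
   4 at most [dl]. *)
pose h := Num.min (r / 2) (dl / 4).
have h0 : 0 < h by rewrite lt_min !divr_gt0.
have hr : h <= r / 2 by rewrite ge_min lexx.
have hd : h <= dl / 4 by rewrite ge_min lexx orbT.
have [d d0 dP] := ga_step h0.
have [L L0 [posL gaL]] := drawing_bounded.
(* The shift leaves a margin [3 * r] to the seam, more than the radius [2 * r] around vertices and
   [2 * h] around arcs. *)
pose L' := L + 3 * r.
pose M' := Num.truncn ((L + L') / h).
pose sc x : R * R := ((x.1 + L') / h, (x.2 + L') / h).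
have closeE c x y : close c (sc x) (sc y) = close (c * h) x y.
  have scB a b : (a + L') / h - (b + L') / h = (a - b) / h.
    by rewrite -mulrBl; congr (_ / _); ring.
  by rewrite /close /= !scB -mulNr !ler_pdivlMr // !ler_pdivrMr.
have boxM x : close L x (0, 0) -> forall a : R, a * h < 3 * r ->
    a < (sc x).1 < M'.+1%:R /\ a < (sc x).2 < M'.+1%:R.
  move=> /closeP[/= x1 x2 x3 x4] a ah.
  have LM : (L + L') / h < M'.+1%:R by apply: truncnS_gt.
  have hi (y : R) : y - 0 <= L -> (y + L') / h < M'.+1%:R.
    by move=> yL; apply: le_lt_trans LM; rewrite ler_pM2r ?invr_gt0 //; lra.
  rewrite !ltr_pdivlMr //= !hi // !andbT /L'; split; lra.
have rh : (2 : R) <= r / h by rewrite ler_pdivlMr //; lra.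
have rK c : c * (r / h) * h = c * r by rewrite -mulrA divfK // gt_eqF.
apply: (@card_edges_discretized R M' V E src tgt (sc \o pos) (fun e => sc \o ga e)
  (r / h) d endsE ends_neq rh d0).
- by move=> u v /=; rewrite closeE rK => c; apply: r1P; apply: close_le c; lra.
- move=> e t w eE t01 /=; rewrite closeE rK => c; apply: r2P eE t01 _.
  by apply: close_le c; lra.
- move=> e f s t eE fE ef s01 t01 /=; rewrite !closeE divfK ?gt_eqF // => c.
  apply: (dlP e f s t eE fE ef s01 t01); apply: close_le c; lra.
- by move=> e s t eE s01 t01 st /=; rewrite closeE mul1r; apply: dP.
- by move=> v; apply: boxM (posL v) _ _; rewrite rK; lra.
- by move=> e t eE t01; apply: boxM (gaL e t eE t01) _ _; lra.
- by move=> e eE /=; rewrite ga_src.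
- by move=> e eE /=; rewrite ga_tgt.
Qed.

End PlanarBound.

Theorem planar_card_edges (R : realType) (V : finType) (G : sgraph V) :
  planar R G -> (3 <= #|V|)%N -> (#|edges G| <= 3 * #|V| - 6)%N.
Proof.
move=> [pos [ga [pos_inj arcs ga_pos ga_ga]]] V3.
have /card_gt0P[v0 _] : (0 < #|V|)%N by apply: leq_trans V3.
have card2 e : e \in edges G -> #|e| = 2 by move/(forall_inP (edgesP G))/eqP.
have /boolp.choice[ends endsP] e : exists uv : V * V, e \in edges G ->
    [/\ e = [set uv.1; uv.2], ga e 0 = pos uv.1 & ga e 1 = pos uv.2].
  have [/arcs[_ _ [u [v uvP]]]|_] := boolP (e \in edges G); last by exists (v0, v0).
  by exists (u, v).
apply: (@card_edges_drawing R V (edges G) pos ga (fun e => (ends e).1)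
  (fun e => (ends e).2)) => //.
- by move=> e /endsP[].
- move=> e eE; apply/eqP => uv; have := card2 e eE.
  by have [-> _ _] := endsP e eE; rewrite uv finset.setUid cards1.
- by move=> e /arcs[gc _ _]; apply: within_continuousP.
- by move=> e /endsP[].
- by move=> e /endsP[].
Qed.

(** * The cube of a path *)

Section PathCube.
Local Open Scope nat_scope.

Definition linked (i j : nat) : bool := (i < j) && (j <= i + 3).

Definition cube_pair (n : nat) (e : {set 'I_n}) (p : 'I_n * 'I_n) : bool :=
  linked p.1 p.2 && (e == [set p.1; p.2]).

Definition cube_edges (n : nat) : {set {set 'I_n}} :=
  [set e | [exists p, cube_pair e p]].

Lemma cube_edgesP n : [forall e in cube_edges n, #|e| == 2].
Proof.
apply/forall_inP => e; rewrite inE => /existsP[[i j] /andP[/andP[/= ij _] /eqP->]].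
by rewrite cards2 (_ : i != j) //; apply: contraTneq ij => ->; rewrite ltnn.
Qed.

Definition path_cube n : sgraph 'I_n := SGraph (cube_edgesP n).

(** An edge has one increasing pair of ends, so the [pick] in [set_color] and [cube_arc] returns
    that pair. *)
Lemma cube_pair_inj n (e : {set 'I_n}) p q : cube_pair e p -> cube_pair e q -> p = q.
Proof.
case: p q => [i j] [k l] /andP[/andP[/= ij _] /eqP->] /andP[/andP[/= kl _] /eqP/setP E].
have := E i; have := E j; have := E k; have := E l; rewrite !inE !eqxx ?orbT /=.
move=> /orP[]/eqP l1 /orP[]/eqP k1 /esym/orP[]/eqP j1 /esym/orP[]/eqP i1;
  move: ij kl; rewrite ?l1 ?k1 ?j1 ?i1 ?ltnn //; subst => //.
all: by move=> ij ji; have := ltn_trans ij ji; rewrite ltnn.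
Qed.

Lemma cube_edge_pair n (e : {set 'I_n}) : e \in path_cube n ->
  exists2 p, cube_pair e p & [pick p | cube_pair e p] = Some p.
Proof.
rewrite inE => /existsP[p ep]; exists p => //; case: pickP => [q eq|/(_ p)].
  by rewrite (cube_pair_inj eq ep).
by rewrite ep.
Qed.

Lemma card_path_cube n : 3 <= n -> 3 * n - 6 <= #|edges (path_cube n)|.
Proof.
pose D := [set p : 'I_n * 'I_n | linked p.1 p.2].
have -> : edges (path_cube n) = [set [set p.1; p.2] | p in D].
  apply/setP => e; rewrite inE; apply/existsP/imsetP => [[p /andP[pl /eqP->]]|[p]].
    by exists p; rewrite // inE.
  by rewrite inE => pl ->; exists p; rewrite /cube_pair pl eqxx.
rewrite card_in_imset => [|p q]; last first.
  rewrite !inE => pl ql E; apply: (@cube_pair_inj _ [set p.1; p.2]).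
    by rewrite /cube_pair pl eqxx.
  by rewrite /cube_pair ql E eqxx.
have -> : #|D| = \sum_(i < n) \sum_(j < n) linked i j.
  rewrite -sum1_card pair_bigA /= big_mkcond /=; apply: eq_bigr => p _.
  by rewrite inE; case: linked.
case: n {D} => [|[|[|n]]] // _.
(* Each vertex after the first three is linked to exactly three earlier ones. *)
suff -> : \sum_(i < n.+3) \sum_(j < n.+3) linked i j = 3 * n + 3 by lia.
elim: n => [|n IH]; first by rewrite !(big_ord_recr, big_ord0) /=.
rewrite big_ord_recr /= [X in _ + X]big1 => [|j _]; last first.
  by rewrite /linked ltnNge -ltnS ltn_ord.
under eq_bigr do rewrite big_ord_recr /=.
rewrite big_split /= IH.
have -> : \sum_(i < n.+3) linked i n.+3 = 3.
  rewrite !big_ord_recr /= big1 => [|i _]; rewrite /linked; last first.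
    by have := ltn_ord i; move: (i : nat) => k; lia.
  have -> : (n < n.+3) && (n.+3 <= n + 3) by lia.
  have -> : (n.+1 < n.+3) && (n.+3 <= n.+1 + 3) by lia.
  by have -> : (n.+2 < n.+3) && (n.+3 <= n.+2 + 3) by lia.
by lia.
Qed.

(* Found by computer search: a proper colouring of the cube of the infinite
   path, invariant under translation by 4, with six colours, and without
   rainbow cycles of length 5 or 6. *)
Definition cube_color (r d : nat) : nat :=
  nth 0 (nth [::] [:: [:: 0; 1; 0; 3]; [:: 2; 2; 4; 4]; [:: 1; 5; 3; 5]] d.-1) r.

Definition pair_color (i j : nat) : nat :=
  if i < j then cube_color (i %% 4) (j - i) else cube_color (j %% 4) (i - j).

Definition set_color n (e : {set 'I_n}) : nat :=
  if [pick p | cube_pair e p] is Some p then pair_color p.1 p.2 else 0.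

Definition adjacent (i j : nat) : bool := linked i j || linked j i.

Lemma pair_colorC i j : pair_color i j = pair_color j i.
Proof. by rewrite /pair_color; case: ltngtP => // ->. Qed.

Lemma pair_color_lt6 i j : pair_color i j < 6.
Proof.
have H r d : cube_color r d < 6.
  case: d => [|[|[|[|d]]]]; case: r => [|[|[|[|r]]]];
    by rewrite //= /cube_color /= ?nth_nil ?nth_default.
by rewrite /pair_color; case: ifP.
Qed.

Lemma path_cube_pair n (i j : 'I_n) : [set i; j] \in path_cube n ->
  adjacent i j /\ set_color [set i; j] = pair_color i j.
Proof.
move=> /cube_edge_pair[[k l] /andP[/= kl /eqP E] pick_kl].
rewrite /set_color pick_kl /=.
have /setP EE := E.
have := EE i; have := EE j; have := EE k; have := EE l; rewrite !inE !eqxx ?orbT /=.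
have nkl : k != l by apply: contraTneq kl => ->; rewrite /linked ltnn.
rewrite /adjacent.
move=> /orP[]/eqP l1 /orP[]/eqP k1 _ _; subst; rewrite ?eqxx ?kl ?orbT // in nkl *.
by split=> //; apply: pair_colorC.
Qed.

(** The clauses treat a common lower end, consecutive edges, and a common upper end. Adding 4 before
    subtracting [d'] avoids truncation and keeps the residue. *)
Lemma cube_color_proper_check : all (fun r => all (fun d => all (fun d' =>
  [&& (d != d') ==> (cube_color r d != cube_color r d'),
      cube_color r d != cube_color ((r + d) %% 4) d' &
      (d != d') ==> (cube_color r d != cube_color ((r + d + 4 - d') %% 4) d')])
  (iota 1 3)) (iota 1 3)) (iota 0 4).
Proof. by vm_compute. Qed.

Lemma linked_color_neq i j k l : linked i j -> linked k l -> (i, j) != (k, l) ->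
  [|| i == k, i == l, j == k | j == l] -> pair_color i j != pair_color k l.
Proof.
move=> ij kl ne share; have [ij' kl'] := (ij, kl).
move: ij' kl' => /andP[ij1 ij2] /andP[kl1 kl2]; rewrite /pair_color ij1 kl1.
have chk a b d d' : a < b <= a + 3 -> d = b - a -> 0 < d' <= 3 ->
  [/\ d != d' -> cube_color (a %% 4) d != cube_color (a %% 4) d',
      cube_color (a %% 4) d != cube_color (b %% 4) d' &
      d != d' -> cube_color (a %% 4) d != cube_color ((b + 4 - d') %% 4) d'].
  move=> ab dE d'3.
  have /(_ (a %% 4)) := allP cube_color_proper_check.
  rewrite mem_iota ltn_pmod // => /(_ isT).
  move=> /allP/(_ d); rewrite mem_iota => /(_ ltac:(lia)).
  move=> /allP/(_ d'); rewrite mem_iota => /(_ ltac:(lia)).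
  move=> /and3P[/implyP h1 h2 /implyP h3].
  have bE : b = a + d by lia.
  split=> //; first by rewrite bE -modnDml.
  move=> /h3; congr (_ != cube_color _ _).
  have -> : b + 4 - d' = a + (d + 4 - d') by lia.
  by rewrite -[in RHS]modnDml; congr (_ %% 4); lia.
case/or4P: share => /eqP E; subst.
- have [h _ _] := chk k j (j - k) (l - k) ltac:(lia) erefl ltac:(lia); apply: h.
  by apply: contraNneq ne => h; apply/eqP; congr (_, _); lia.
- have [_ h _] := chk k l (l - k) (j - l) ltac:(lia) erefl ltac:(lia).
  by rewrite eq_sym.
- by have [_ h _] := chk i k (k - i) (l - k) ltac:(lia) erefl ltac:(lia).
- have [_ _ h] := chk i l (l - i) (l - k) ltac:(lia) erefl ltac:(lia).
  have -> : k %% 4 = (l + 4 - (l - k)) %% 4.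
    by rewrite (_ : l + 4 - (l - k) = k + 4) ?modnDr //; lia.
  by apply: h; apply: contraNneq ne => h; apply/eqP; congr (_, _); lia.
Qed.

Lemma path_cube_proper n : proper_edge_coloring (path_cube n) (@set_color n).
Proof.
move=> e f eG fG ef.
have [[i j] ep pe] := cube_edge_pair eG; have [[k l] fp pf] := cube_edge_pair fG.
rewrite /set_color pe pf /=.
case/andP: ep fp => /= ij /eqP eE /andP[/= kl /eqP fE].
rewrite -setI_eq0 => /set0Pn[x]; rewrite inE eE fE !inE => /andP[xij xkl].
apply: linked_color_neq => //.
  apply: contraNneq ef => -[/val_inj ik /val_inj jl].
  by rewrite eE fE ik jl.
by case/orP: xij xkl => /eqP-> /orP[]/eqP->; rewrite eqxx ?orbT.
Qed.

(** * Search for rainbow cycles of length 5 and 6 *)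

Definition neighbours (a : nat) : seq nat :=
  [:: a - 3; a - 2; a - 1; a + 1; a + 2; a + 3].

(* No rainbow cycle through [x0] extends, by [fuel] further vertices, the path
   with current end [a], vertices [vis] and edge colours [cols]. *)
Fixpoint no_rainbow_ext (fuel x0 a : nat) (cols vis : seq nat) : bool :=
  if fuel is fuel'.+1 then
    all (fun b => [|| b \in vis, pair_color a b \in cols |
      no_rainbow_ext fuel' x0 b (pair_color a b :: cols) (b :: vis)]) (neighbours a)
  else ~~ (adjacent a x0 && (pair_color a x0 \notin cols)).

Lemma adjacent_neighbours a b : adjacent a b -> b \in neighbours a.
Proof. by rewrite /adjacent /linked !inE; lia. Qed.

Lemma no_rainbow_extS fuel x0 a cols vis :
  no_rainbow_ext fuel.+1 x0 a cols vis =
  all (fun b => [|| b \in vis, pair_color a b \in cols |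
    no_rainbow_ext fuel x0 b (pair_color a b :: cols) (b :: vis)]) (neighbours a).
Proof. by []. Qed.

(** Induction on the vertices [s] still to be visited before the cycle closes at [x0]. *)
Lemma no_rainbow_ext_sound s x0 a cols vis :
    no_rainbow_ext (size s) x0 a cols vis -> path adjacent a (rcons s x0) ->
  uniq (vis ++ s) -> ~~ uniq (cols ++ pairmap pair_color a (rcons s x0)).
Proof.
elim: s a cols vis => [|b s IH] a cols vis.
  rewrite /= !andbT negb_and negbK => /orP[/negPf->//|ac _ _].
  by rewrite cat_uniq /= orbF ac /= andbF.
rewrite [size _]/= no_rainbow_extS => /allP/(_ b) H /= /andP[ab bs].
move: (H (adjacent_neighbours ab)).
case/or3P => [bv|bc|/IH/(_ bs) {}IH].
- by rewrite cat_uniq /= bv /= andbF.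
- by rewrite [in X in _ -> X]cat_uniq /= bc /= andbF.
move=> vu; rewrite -cat1s uniq_catCA /= in vu; apply: contra (IH vu).
by rewrite -cat1s uniq_catCA.
Qed.

(** The starts cover all residues modulo 4 and exceed 15, the most that five steps can descend. Fuel
    4 and 5 give lengths 5 and 6. *)
Lemma no_rainbow_check : all (fun x => no_rainbow_ext 4 x x [::] [:: x] &&
  no_rainbow_ext 5 x x [::] [:: x]) (iota 20 4).
Proof. by vm_compute. Qed.

Lemma pair_color_shift i j : pair_color (i + 4) (j + 4) = pair_color i j.
Proof. by rewrite /pair_color ltn_add2r !subnDr !modnDr. Qed.

Lemma pair_color_shiftM i j m : pair_color (i + m * 4) (j + m * 4) = pair_color i j.
Proof.
elim: m => [|m IH]; first by rewrite !addn0.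
by rewrite mulSn ![_ + (4 + _)]addnCA ![4 + _]addnC pair_color_shift.
Qed.


Lemma path_map_iota (f : nat -> nat) (r : rel nat) m k :
  (forall j, m <= j < m + k -> r (f j) (f j.+1)) ->
  path r (f m) (map f (iota m.+1 k)).
Proof.
elim: k m => //= k IH m fr; apply/andP; split; first by apply: fr; lia.
by apply: IH => j jk; apply: fr; lia.
Qed.

Lemma pairmap_map_iota (f : nat -> nat) (c : nat -> nat -> nat) m k :
  pairmap c (f m) (map f (iota m.+1 k)) = map (fun j => c (f j) (f j.+1)) (iota m k).
Proof. by elim: k m => //= k IH m; rewrite IH. Qed.

Lemma no_short_rainbow (k : nat) (f : nat -> nat) : k.+1 = 5 \/ k.+1 = 6 ->
    f k.+1 = f 0 -> (forall j, adjacent (f j) (f j.+1)) ->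
    {in iota 0 k.+1 &, injective f} ->
  ~ {in iota 0 k.+1 &, injective (fun j => pair_color (f j) (f j.+1))}.
Proof.
move=> k56 fk fnear f_inj c_inj.
(* Translating by a multiple of 4 moves [f 0] into [20, 24). *)
pose q := f 0 %/ 4; pose g j := (f j + 5 * 4) - q * 4.
have g0 : g 0 \in iota 20 4.
  rewrite mem_iota /g {1}(divn_eq (f 0) 4) -/q.
  by have := ltn_pmod (f 0) (isT : 0 < 4); lia.
(* Labels drop by at most 3 per step, so the subtraction in [g] does not truncate. *)
have lb j : j <= 6 -> f 0 <= f j + 3 * j.
  elim: j => [|j IH] j6; first lia.
  by have := fnear j; have := IH (ltnW j6); rewrite /adjacent /linked; lia.
have gf j : j <= 6 -> g j + q * 4 = f j + 5 * 4.
  move=> j6; rewrite /g subnK //; have := lb j j6.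
  by rewrite {1}(divn_eq (f 0) 4) -/q; lia.
have gnear j : j < 6 -> adjacent (g j) (g j.+1).
  move=> j6; have := fnear j; have := gf j (ltnW j6); have := gf j.+1 j6.
  by rewrite /adjacent /linked; lia.
have gcol j : j < 6 -> pair_color (g j) (g j.+1) = pair_color (f j) (f j.+1).
  move=> j6; rewrite -(pair_color_shiftM (g j) _ q) !gf // ?pair_color_shiftM //.
  exact: ltnW.
have closed : rcons (map g (iota 1 k)) (g 0) = map g (iota 1 k.+1).
  by rewrite -[X in iota 1 X.+1]addn0 -addnS iotaD map_cat cats1 add1n /g fk.
have := @no_rainbow_ext_sound (map g (iota 1 k)) (g 0) (g 0) [::] [:: g 0].
rewrite size_map size_iota closed cat0s pairmap_map_iota => H.
have k6 j : j \in iota 0 k.+1 -> j < 6 by rewrite mem_iota; lia.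
have /negP[] : ~~ uniq (map (fun j => pair_color (g j) (g j.+1)) (iota 0 k.+1)).
  apply: H.
  - have /andP[h4 h5] := allP no_rainbow_check _ g0.
    by case: k56 => -[->]; [exact: h4|exact: h5].
  - by apply: path_map_iota => j jk; apply: gnear; lia.
  - have -> : [:: g 0] ++ map g (iota 1 k) = map g (iota 0 k.+1) by [].
    rewrite map_inj_in_uniq ?iota_uniq // => i j iI jI gij; apply: f_inj => //.
    by have := gf i (ltnW (k6 i iI)); have := gf j (ltnW (k6 j jI)); lia.
rewrite map_inj_in_uniq ?iota_uniq // => i j iI jI; rewrite !gcol ?k6 //.
exact: c_inj.
Qed.

Theorem path_cube_no_rainbow n k : 5 <= k ->
  ~ has_rainbow_copy (cycle_graph k) (path_cube n) (@set_color n).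
Proof.
case: k => // k k5 [phi [phi_inj sub rb]].
have ordS_neq (i : 'I_k.+1) : i != ordS i.
  rewrite -(inj_eq val_inj) /=; have := ltn_ord i; rewrite ltnS leq_eqVlt.
  case/orP => [/eqP->|ik]; last by rewrite modn_small // ltn_eqF.
  by rewrite modnn; lia.
pose ce i := [set phi i; phi (ordS i)].
have ceE (i : 'I_k.+1) : ce i = phi @: [set i; ordS i] by rewrite imsetU1 imset_set1.
have ce_in i : ce i \in [set phi @: (h : {set 'I_k.+1}) | h in edges (cycle_graph k.+1)].
  rewrite ceE; apply: imset_f; apply/imsetP; exists i => //.
  by rewrite inE ordS_neq.
have ce_G i : ce i \in path_cube n by apply: (fintype.subsetP sub).
(* Equal edges at distinct indices would be traversed in opposite directions, so two steps would
   close the cycle. *)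
have ce_inj : injective ce.
  move=> i j; rewrite !ceE => /(imset_inj phi_inj)/setP E.
  have := E i; have := E (ordS i); rewrite !inE !eqxx orbT /=.
  move=> /esym/orP[]/eqP a /esym/orP[]/eqP b //; last exact: (can_inj (@ordSK _)).
  move/(congr1 val): a; rewrite b /=; move/(congr1 val): b => /= b.
  have := ltn_ord j; move: (val j) => y yk; rewrite -addn1 modnDml addn1.
  have [yk'|yk'] := ltnP y.+2 k.+1; first by rewrite modn_small //; lia.
  by rewrite -(subnK yk') modnDr modn_small; lia.
pose col i := pair_color (phi i) (phi (ordS i)).
have col_inj : injective col.
  move=> i j; rewrite /col.
  have [_ <-] := path_cube_pair (ce_G i); have [_ <-] := path_cube_pair (ce_G j).
  by move=> /(rb _ _ (ce_in i) (ce_in j))/ce_inj.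
(* A rainbow cycle needs one colour per edge, and there are six. *)
have k6 : k.+1 <= 6.
  pose col6 i : 'I_6 := Ordinal (pair_color_lt6 (phi i) (phi (ordS i))).
  have : injective col6 by move=> i j [] /col_inj.
  by move=> /leq_card; rewrite !card_ord.
pose o j : 'I_k.+1 := inord (j %% k.+1).
have oS j : o j.+1 = ordS (o j).
  by apply: val_inj; rewrite /= !inordK ?ltn_pmod // -addn1 -[in RHS]addn1 modnDml.
have o_inj : {in iota 0 k.+1 &, injective o}.
  move=> i j; rewrite !mem_iota add0n => /andP[_ ik] /andP[_ jk].
  by move=> /(congr1 val); rewrite /= !inordK ?ltn_pmod // !modn_small.
apply: (@no_short_rainbow k (fun j => phi (o j))).
- by lia.
- by congr (nat_of_ord (phi _)); rewrite /o modnn mod0n.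
- by move=> j; rewrite oS; have [] := path_cube_pair (ce_G (o j)).
- by move=> i j iI jI /val_inj/phi_inj/o_inj; apply.
- by move=> i j iI jI; rewrite !oS => /col_inj/o_inj; apply.
Qed.

End PathCube.

(** * A straight line drawing *)

Section Drawing.
Variable R : realType.
Local Open Scope ring_scope.

(* Writing p_i for [cube_pos i], [shrink] maps the triangle p_0 p_1 p_2 to
   p_1 p_2 p_3, where p_3 is the barycentre of the former. *)
Definition shrink (x : R * R) : R * R := (- (x.2 / 3), x.1 - 2 / 3 * x.2).

Definition cube_pos (i : nat) : R * R := iter i shrink (1, 0).

Definition seg (a b : R * R) (t : R) : R * R :=
  (a.1 + t * (b.1 - a.1), a.2 + t * (b.2 - a.2)).

Lemma shrink_inj : injective shrink.
Proof.
move=> [a b] [c d] [/= e1 e2].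
have bd : b = d by lra.
by rewrite bd in e2 *; congr (_, _); lra.
Qed.

Lemma shrink_seg a b t : shrink (seg a b t) = seg (shrink a) (shrink b) t.
Proof. by rewrite /shrink /seg /=; congr (_, _); ring. Qed.

Lemma seg0 a b : seg a b 0 = a.
Proof. by case: a => a1 a2; rewrite /seg /= !mul0r !addr0. Qed.

Lemma seg1 a b : seg a b 1 = b.
Proof. by case: a b => [a1 a2] [b1 b2]; rewrite /seg /=; congr (_, _); ring. Qed.

Lemma cube_posS i : cube_pos i.+1 = shrink (cube_pos i).
Proof. by []. Qed.

(** The triangle p_0 p_1 p_2, one inequality per side. *)
Definition in_triangle (x : R * R) : Prop :=
  [/\ x.1 + x.2 <= 1, x.2 <= 1 + 5 * x.1 & x.1 <= 1 + 2 * x.2].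

(** The triangle p_1 p_2 p_3, which contains every point after p_0. *)
Definition in_inner_triangle (x : R * R) : Prop :=
  [/\ x.2 <= 1 + 5 * x.1, 7 * x.1 <= 1 + 5 * x.2 & 4 * x.1 + x.2 <= 1].

Lemma in_inner_shrink x : in_triangle x -> in_inner_triangle (shrink x).
Proof. by case=> ? ? ?; split=> /=; lra. Qed.

Lemma in_inner_sub x : in_inner_triangle x -> in_triangle x.
Proof. by case=> ? ? ?; split=> /=; lra. Qed.

Lemma cube_pos_in i : in_triangle (cube_pos i).
Proof.
elim: i => [|i IH]; first by split=> /=; lra.
by rewrite cube_posS; apply/in_inner_sub/in_inner_shrink.
Qed.

Lemma cube_posS_in i : in_inner_triangle (cube_pos i.+1).
Proof. exact/in_inner_shrink/cube_pos_in. Qed.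

Lemma convex_combination (c a b t : R) :
  0 <= t <= 1 -> a <= c -> b <= c -> a + t * (b - a) <= c.
Proof. by move=> /andP[t0 t1] ac bc; nra. Qed.

Lemma in_inner_seg a b t : 0 <= t <= 1 ->
  in_inner_triangle a -> in_inner_triangle b -> in_inner_triangle (seg a b t).
Proof.
move=> t01 [a1 a2 a3] [b1 b2 b3].
have := @convex_combination 1 (a.2 - 5 * a.1) (b.2 - 5 * b.1) t t01.
have := @convex_combination 1 (7 * a.1 - 5 * a.2) (7 * b.1 - 5 * b.2) t t01.
have := @convex_combination 1 (4 * a.1 + a.2) (4 * b.1 + b.2) t t01.
move=> h3 h2 h1; split=> /=.
- by have := h1 ltac:(lra) ltac:(lra); lra.
- by have := h2 ltac:(lra) ltac:(lra); lra.
- by have := h3 ltac:(lra) ltac:(lra); lra.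
Qed.

(** This separates the edges at p_0 from all later ones, which lie in the inner triangle. *)
Lemma seg0_not_inner j t : linked 0 j -> t < 1 ->
  ~ in_inner_triangle (seg (cube_pos 0) (cube_pos j) t).
Proof.
case: j => [|[|[|[|j]]]] // _ t1 []; rewrite /cube_pos /seg /shrink /= => ? ? ?; lra.
Qed.

Lemma cube_pos0_not_inner : ~ in_inner_triangle (cube_pos 0).
Proof. by case=> /= ? ? ?; lra. Qed.

Lemma cube_pos_inj : injective cube_pos.
Proof.
elim=> [|i IH] [|j] // ij.
- by case: cube_pos0_not_inner; rewrite ij; apply: cube_posS_in.
- by case: cube_pos0_not_inner; rewrite -ij; apply: cube_posS_in.
by rewrite (IH j) //; apply: shrink_inj.
Qed.

Lemma linkedS i j : linked i.+1 j.+1 = linked i j.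
Proof. by rewrite /linked addSn !ltnS. Qed.

(** Undoing [shrink] reduces to the case where the edge starts at p_0 or the vertex is p_0. *)
Lemma seg_avoids_pos i j w t : linked i j -> 0 < t < 1 ->
  seg (cube_pos i) (cube_pos j) t <> cube_pos w.
Proof.
move=> + t01; have /andP[t0 t1] := t01.
elim: i j w => [|i IH] j w ij E.
  case: w E => [|w] E; last first.
    by apply: (seg0_not_inner ij t1); rewrite E; apply: cube_posS_in.
  move: E; case: j ij => [|[|[|[|j]]]] // _ [/=]; rewrite /cube_pos /shrink /= => ? ?; lra.
case: j ij E => [|j] // ij; case: w => [|w] E.
  apply: cube_pos0_not_inner; rewrite -E.
  by apply: in_inner_seg; rewrite ?ltW //; apply: cube_posS_in.
rewrite linkedS in ij; apply: (IH j w ij); apply: shrink_inj.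
by rewrite shrink_seg.
Qed.

Lemma seg_avoids_seg i j k l s t : linked i j -> linked k l -> (i, j) != (k, l) ->
  0 < s < 1 -> 0 <= t <= 1 ->
  seg (cube_pos i) (cube_pos j) s <> seg (cube_pos k) (cube_pos l) t.
Proof.
move=> + + + s01 t01; have /andP[s0 s1] := s01; have /andP[t0 t1] := t01.
elim: i j k l => [|i IH] j [|k] l ij kl ne E.
(* Both segments leave p_0 in explicit directions, so the equations are linear in [s] and [t]. *)
- have jl : (j != l)%N by apply: contraNneq ne => ->.
  move: E; rewrite /seg => -[].
  case: j ij jl {ne} => [|[|[|[|j]]]] // _; case: l kl => [|[|[|[|l]]]] // _ _;
    rewrite /cube_pos /shrink /= => ? ?; lra.
- case: l kl ne E => [|l] // kl _ E.
  apply: (seg0_not_inner ij s1); rewrite E.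
  by apply: in_inner_seg => //; apply: cube_posS_in.
(* At [t = 1] the edge from p_0 does reach the inner triangle, but at a vertex, which the other edge
   avoids. *)
- have [t1'|t1'] := ltP t 1.
    apply: (seg0_not_inner kl t1'); rewrite -E.
    case: j ij {ne E} => [|j] // _.
    by apply: in_inner_seg; rewrite ?ltW //; apply: cube_posS_in.
  apply: (seg_avoids_pos (w := l) ij s01); rewrite E.
  have -> : t = 1 by lra.
  exact: seg1.
case: j l ij kl ne E => [|j] // [|l] // ij kl ne E.
rewrite !linkedS in ij kl; apply: (IH j k l ij kl).
  by apply: contraNneq ne => -[-> ->].
by apply: shrink_inj; rewrite !shrink_seg.
Qed.

Lemma seg_continuous a b : continuous (seg a b).
Proof.
move=> t.
have affine (c d : R) : (c + x * d @[x --> t] --> c + t * d)%classic.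
  by apply: cvgD; [exact: cvg_cst|apply: cvgM; [exact: cvg_id|exact: cvg_cst]].
exact: cvg_pair (affine a.1 (b.1 - a.1)) (affine a.2 (b.2 - a.2)).
Qed.

Lemma seg_inj a b : a <> b -> injective (seg a b).
Proof.
move=> ab s t [/addrI e1 /addrI e2].
have [b1|b1] := eqVneq (b.1 - a.1) 0; last exact: (mulIf b1).
have [b2|b2] := eqVneq (b.2 - a.2) 0; last exact: (mulIf b2).
case: ab; rewrite [a]surjective_pairing [b]surjective_pairing.
by congr (_, _); apply/eqP; rewrite eq_sym -subr_eq0 ?b1 ?b2.
Qed.

Definition cube_arc n (e : {set 'I_n}) : R -> R * R :=
  if [pick p | cube_pair e p] is Some p then seg (cube_pos p.1) (cube_pos p.2)
  else fun=> 0.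

Theorem path_cube_planar n : planar R (path_cube n).
Proof.
exists (fun v : 'I_n => cube_pos v), (@cube_arc n); split.
- by move=> u v /cube_pos_inj/val_inj.
- move=> e /cube_edge_pair[[i j] /andP[/= ij /eqP eE] pe]; rewrite /cube_arc pe /=.
  split.
  + exact/continuous_subspaceT/seg_continuous.
  + have nij : cube_pos i <> cube_pos j.
      by move=> /cube_pos_inj E; move: ij; rewrite /linked E ltnn.
    by move=> s t _ _; apply: seg_inj.
  by exists i, j; rewrite seg0 seg1.
- move=> e v t /cube_edge_pair[[i j] /andP[/= ij _] pe]; rewrite in_itv /= => t01.
  by rewrite /cube_arc pe; apply: seg_avoids_pos.
move=> e f s t /cube_edge_pair[[i j] /andP[/= ij /eqP eE] pe].
move=> /cube_edge_pair[[k l] /andP[/= kl /eqP fE] pf] ef; rewrite !in_itv /= => s01 t01.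
rewrite /cube_arc pe pf; apply: seg_avoids_seg => //.
by apply: contraNneq ef => -[/val_inj ik /val_inj jl]; rewrite eE fE ik jl.
Qed.

End Drawing.

Theorem theorem3 (R : realType) (n k : nat) (hn : (3 <= n)%N) (hk : (5 <= k)%N) :
  rainbow_planar_turan R n (cycle_graph k) = (3 * n - 6)%N.
Proof.
apply/eqP; rewrite eqn_leq; apply/andP; split.
  apply/bigmax_leqP => G /asboolP[Gplanar _].
  by have := planar_card_edges Gplanar; rewrite card_ord; apply.
apply: leq_trans (card_path_cube hn) _.
apply: (@leq_bigmax_cond _ _ (fun G : sgraph 'I_n => #|edges G|)).
apply/asboolP; split; first exact: path_cube_planar.
exists (@set_color n); split; first exact: path_cube_proper.
exact: path_cube_no_rainbow.
Qed.
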